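(* Let $\lambda\ge0$ and consider the system $$S'=-\tfrac{1}{3\sqrt3}-\tfrac23S+\tfrac1{\sqrt3}S^2+\tfrac1{\sqrt3}U^2+\tfrac1{2\sqrt3}P^2+2S^3-SU^2+SP^2,$$ $$U'=U\bigl(\tfrac13-\tfrac\lambda2P+2S^2-U^2+P^2\bigr),\qquad P'=-\tfrac23P+\lambda U^2+2S^2P-U^2P+P^3,$$ and its set of critical points $\Sigma=\{(S,0,P): 3S^2+\frac32P^2=1\}$. Let $P_\Sigma=(S_0,0,P_0)\in\Sigma$. The linearization at $P_\Sigma$ has eigenvalues $$\varepsilon_1=0,\qquad \varepsilon_2=1-\tfrac\lambda2P_0,\qquad \varepsilon_3=\tfrac23(2+\sqrt3\,S_0).$$ Moreover: (a) if $\lambda P_0>2$, then $P_\Sigma$ is unstable both to the future and to the past; (b) if $\lambda P_0<2$, then $P_\Sigma$ is unstable to the future, and for $\tau\to-\infty$ it is attracting in the sense that $P_\Sigma$ is stable to the past and every solution starting in a sufficiently small neighborhood of $P_\Sigma$ converges to $\Sigma$ as $\tau\to-\infty$; (c) if $\lambda<\sqrt6$, then $\Sigma$ as a whole is a past-attractor: there is a neighborhood of $\Sigma$ such that every solution starting in it converges to $\Sigma$ as $\tau\to-\infty$.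
   Context: The prime denotes $d/d\tau$; stability to the future (past) is Lyapunov stability for the system (for the time-reversed system), in $\mathbb{R}^3$ with coordinates $(S,U,P)$. Convergence to $\Sigma$ means the distance to $\Sigma$ tends to $0$. *)

(* Defs.v *)
From mathcomp Require Import all_boot all_order all_algebra.
From mathcomp Require Import all_classical all_reals all_analysis.

Set Implicit Arguments.
Unset Strict Implicit.
Unset Printing Implicit Defensive.

Import Order.TTheory GRing.Theory Num.Theory.
Import numFieldNormedType.Exports.

Local Open Scope classical_set_scope.
Local Open Scope ring_scope.

Section Autonomous.
Variables (R : realType) (V : normedModType R).
Implicit Types (f : V -> V) (x : R -> V) (J : set R).

(* The values of x outside J are irrelevant. *)
Definition solution f J x :=
  [/\ open J, is_interval J, J 0 &
      forall t, J t -> is_derive t 1 x (f (x t))].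

Definition maximal_solution f J x :=
  solution f J x /\
  forall J' y, solution f J' y -> J `<=` J' ->
    (forall t, J t -> y t = x t) -> J' `<=` J.

(* Global existence towards the future is part of Lyapunov stability. *)
Definition future_stable f (p : V) :=
  forall eps : R, 0 < eps -> exists2 delta : R, 0 < delta &
    forall J x, maximal_solution f J x -> `|x 0 - p| < delta ->
      forall t, 0 <= t -> J t /\ `|x t - p| < eps.

(* If x solves x' = f x, then t |-> x (- t) solves x' = - f x. *)
Definition time_reversed f : V -> V := fun X => - f X.

Definition past_stable f (p : V) := future_stable (time_reversed f) p.

(* Values of x outside J do not enter the limit, since J contains all t <= 0. *)
Definition past_converges f (A : set V) (X : V) :=
  forall J x, maximal_solution f J x -> x 0 = X ->
    (forall t, t <= 0 -> J t) /\
    edist_inf A (x t) @[t --> -oo] --> 0%E.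

End Autonomous.

Section System.
Variable R : realType.

(* The norm of 'rV[R]_3 is the sup norm; stability and convergence do not depend
   on the choice of a norm. *)
Definition vec3 (S U P : R) : 'rV[R]_3 := \row_(i < 3) [:: S; U; P]`_i.

Definition Scoord (X : 'rV[R]_3) : R := X 0 0.
Definition Ucoord (X : 'rV[R]_3) : R := X 0 1.
Definition Pcoord (X : 'rV[R]_3) : R := X 0 2.

Definition vector_field (lambda : R) (X : 'rV[R]_3) : 'rV[R]_3 :=
  let S := Scoord X in let U := Ucoord X in let P := Pcoord X in
  vec3
    (- (1 / (3 * Num.sqrt 3)) - 2 / 3 * S
       + 1 / Num.sqrt 3 * S ^+ 2 + 1 / Num.sqrt 3 * U ^+ 2
       + 1 / (2 * Num.sqrt 3) * P ^+ 2
       + 2 * S ^+ 3 - S * U ^+ 2 + S * P ^+ 2)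
    (U * (1 / 3 - lambda / 2 * P + 2 * S ^+ 2 - U ^+ 2 + P ^+ 2))
    (- (2 / 3) * P + lambda * U ^+ 2 + 2 * S ^+ 2 * P - U ^+ 2 * P + P ^+ 3).

Definition Sigma : set 'rV[R]_3 :=
  [set X | Ucoord X = 0 /\ 3 * Scoord X ^+ 2 + 3 / 2 * Pcoord X ^+ 2 = 1].

End System.

(* Main.v *)
Require Import Defs.
From mathcomp Require Import all_boot all_order all_algebra.
From mathcomp Require Import all_classical all_reals all_analysis.
From mathcomp Require Import ring lra.

(** With E = 3 S^2 + 3/2 P^2 - 1 the system reads
      S' = 2/3 E (S + 1/(2 sqrt 3)) + U^2 (1/sqrt 3 - S),
      U' = U (1 - lambda/2 P + 2/3 E - U^2),
      P' = 2/3 E P + U^2 (lambda - P),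
    so that E' = a E + b U^2 with a = 2/3 (2 + sqrt 3 S) > 0 on Sigma.
    Instability: on the invariant plane U = 0 the quantity E^2 grows
    exponentially near Sigma, and backwards in time U^2 does so when
    lambda P0 > 2.  Attraction when lambda P0 < 2: backwards in time
    W = E^2 + K U^4 decays exponentially for K large, and since |S'| and |P'|
    are O(|E| + U^2) the total displacement is O(sqrt (W 0)); this traps the
    solution near P_Sigma, and |E|, |U| -> 0 is convergence to Sigma.
    If 0 <= lambda < sqrt 6 then lambda P0 < 2 on all of Sigma, which gives (c).

    Maximal solutions come from the Picard-Lindeloef theorem for globally
    Lipschitz fields, applied to the field composed with a clamp onto a cube. *)

Set Implicit Arguments.
Unset Strict Implicit.
Unset Printing Implicit Defensive.

Import Order.TTheory GRing.Theory Num.Theory.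
Import numFieldNormedType.Exports.

Local Open Scope classical_set_scope.
Local Open Scope ring_scope.

(** * Calculus on the line *)

Lemma near_normP (R : realType) (V : normedModType R) (x : V) (P : set V) :
  (\forall y \near x, P y) <-> exists2 r : R, 0 < r & forall y, `|y - x| < r -> P y.
Proof.
split=> [/nbhs_ballP[r /= r0 rP]|[r r0 rP]].
  by exists r => // y yx; apply: rP; rewrite -ball_normE/= distrC.
by apply/nbhs_ballP; exists r => // y; rewrite -ball_normE/= distrC; exact: rP.
Qed.

Lemma continuous_normP (R : realType) (V W : normedModType R) (f : V -> W) (x : V) :
  {for x, continuous f} <-> forall e : R, 0 < e -> exists2 r : R, 0 < r &
    forall y, `|y - x| < r -> `|f y - f x| < e.
Proof.
split=> [cf e e0|H].
  apply/near_normP; move/cvgrPdist_lt: cf => /(_ e e0).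
  by apply: filterS => y; rewrite distrC.
apply/cvgrPdist_lt => e /H[r r0 rP]; apply/near_normP; exists r => // y.
by rewrite [X in _ -> X < _]distrC; exact: rP.
Qed.

Lemma is_derive_continuous (R : realType) (V : normedModType R) (x : R -> V)
  (t : R) (v : V) : is_derive t 1 x v -> {for t, continuous x}.
Proof. by move=> [xt _]; apply: differentiable_continuous; apply/derivable1_diffP. Qed.

Lemma is_derive_ge0_le (R : realType) (q dq : R -> R) (a b : R) : a <= b ->
  (forall s, a <= s <= b -> is_derive s 1 q (dq s)) ->
  (forall s, a < s < b -> 0 <= dq s) -> q a <= q b.
Proof.
rewrite le_eqVlt => /predU1P[-> //|ab] qE dq0.
have [||c cab qba] := @MVT R q dq a b ab.
- by move=> s; rewrite in_itv/= => /andP[/ltW ? /ltW ?]; apply: qE; apply/andP.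
- apply: continuous_in_subspaceT => s; rewrite inE/= in_itv/= => sab.
  exact: is_derive_continuous (qE _ sab).
- rewrite -subr_ge0 qba mulr_ge0 ?subr_ge0 ?(ltW ab)//.
  by apply: dq0; move: cab; rewrite in_itv.
Qed.

(** A mean value inequality with the majorant [h] in the role of a constant: [h - q] and [h + q]
    both have nonnegative derivative. *)
Lemma is_derive_dist_le (R : realType) (q dq h dh : R -> R) (a b : R) : a <= b ->
  (forall s, a <= s <= b -> is_derive s 1 q (dq s)) ->
  (forall s, a <= s <= b -> is_derive s 1 h (dh s)) ->
  (forall s, a < s < b -> `|dq s| <= dh s) -> `|q b - q a| <= h b - h a.
Proof.
move=> ab qE hE qh.
have H1 : (h - q) a <= (h - q) b.
  apply: (@is_derive_ge0_le _ _ (fun s => dh s - dq s)) => // s sab.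
    by have := qE _ sab; have := hE _ sab => ? ?; apply: is_deriveB.
  by have := qh _ sab; rewrite ler_norml subr_ge0 => /andP[].
have H2 : (h + q) a <= (h + q) b.
  apply: (@is_derive_ge0_le _ _ (fun s => dh s + dq s)) => // s sab.
    by have := qE _ sab; have := hE _ sab => ? ?; apply: is_deriveD.
  by have := qh _ sab; rewrite ler_norml => /andP[]; lra.
move: H1 H2; rewrite !fctE ler_norml; lra.
Qed.

Lemma is_derive_expRM (R : realType) (k t : R) :
  is_derive t 1 (fun s => expR (k * s)) (k * expR (k * t)).
Proof.
have -> : (fun s => expR (k * s)) = expR \o (fun s => k *: s) by [].
by apply: is_derive_eq; rewrite /GRing.scale/= mulr1 mulrC.
Qed.

Lemma gronwall (R : realType) (q dq : R -> R) (k T : R) : 0 <= T ->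
  (forall s, 0 <= s <= T -> is_derive s 1 q (dq s)) ->
  (forall s, 0 < s < T -> dq s <= k * q s) -> q T <= q 0 * expR (k * T).
Proof.
move=> T0 qE dqk.
(* The integrating factor makes [q s * expR (- k * s)] nonincreasing; the sign turns this into the
   monotone case above. *)
pose w s := - (q s * expR (- k * s)).
have : w 0 <= w T.
  apply: (@is_derive_ge0_le _ _
    (fun s => (k * q s - dq s) * expR (- k * s))) => // s sT.
    have := qE _ sT; have := is_derive_expRM (- k) s => ? ?.
    rewrite /w; apply: is_derive_eq; rewrite /GRing.scale/=; ring.
  by rewrite mulr_ge0 ?expR_ge0 ?subr_ge0 ?dqk.
rewrite /w lerN2 mulr0 expR0 mulr1 mulNr expRN => h.
by rewrite -ler_pdivrMr ?expR_gt0.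
Qed.

Lemma gronwall_ge (R : realType) (q dq : R -> R) (k T : R) : 0 <= T ->
  (forall s, 0 <= s <= T -> is_derive s 1 q (dq s)) ->
  (forall s, 0 < s < T -> k * q s <= dq s) -> q 0 * expR (k * T) <= q T.
Proof.
move=> T0 qE dqk; rewrite -lerN2 -mulNr.
apply: (@gronwall _ (fun s => - q s) (fun s => - dq s)) => // s sT.
  by have := qE _ sT => ?; apply: is_deriveN.
by rewrite mulrN lerN2 dqk.
Qed.

Lemma eq_ball_is_derive (R : realType) (V : normedModType R) (x y : R -> V)
    (t r : R) (v : V) : 0 < r -> (forall s, `|s - t| < r -> x s = y s) ->
  is_derive t 1 x v -> is_derive t 1 y v.
Proof.
move=> r0 xy; apply: near_eq_is_derive; apply/near_normP.
by exists r.
Qed.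

(* Local primitives vanishing at 0 agree wherever both are defined, so they
   glue to a global one. *)
Lemma exists_primitive (R : realType) (g : R -> R) : continuous g ->
  exists G : R -> R, G 0 = 0 /\ forall t : R, is_derive t 1 G (g t).
Proof.
move=> cg.
have loc (N : R) : 0 < N -> exists G : R -> R, G 0 = 0 /\
    forall t : R, `|t| < N -> is_derive t 1 G (g t).
  move=> N0.
  (* Integrating from [- N] rather than from 0 keeps negative times interior; subtracting [I 0]
     restores the normalization at 0. *)
  pose I t := (\int[lebesgue_measure]_(s in `[- N, t]) g s)%R.
  exists (fun t => I t - I 0); split=> [|t tN]; first by rewrite subrr.
  move: tN; rewrite ltr_norml => /andP[Nt tN].
  have [dI IE] : derivable I t 1 /\ derive1 I t = g t.
    apply: (@continuous_FTC1_closed _ _ (- N) t N) => //; last exact: cg.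
    apply: continuous_compact_integrable; first exact: segment_compact.
    exact: continuous_subspaceT.
  have It : is_derive t 1 I (g t) by rewrite -IE derive1E; exact: derivableP.
  by rewrite -[X in is_derive _ _ _ X]subr0; apply: is_deriveB.
(* The condition on [N] moves under the existential, with a dummy function for [N <= 0], so that a
   family indexed by all reals can be chosen. *)
have {}loc (N : R) : exists G : R -> R, 0 < N -> G 0 = 0 /\
    forall t : R, `|t| < N -> is_derive t 1 G (g t).
  have [/loc[G GP]|N0] := ltP 0 N; first by exists G.
  by exists (fun=> 0).
pose H N := sval (cid (loc N)).
have HP N : 0 < N -> H N 0 = 0 /\
    forall t : R, `|t| < N -> is_derive t 1 (H N) (g t).
  exact: (svalP (cid (loc N))).
have HH N M t : `|t| < N -> `|t| < M -> H N t = H M t.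
  move=> tN tM.
  have [HN0 HN] := HP N (le_lt_trans (normr_ge0 _) tN).
  have [HM0 HM] := HP M (le_lt_trans (normr_ge0 _) tM).
  have D (s : R) : `|s| <= `|t| -> is_derive s 1 (H N - H M) 0.
    move=> st; rewrite -(subrr (g s)).
    have := HN _ (le_lt_trans st tN); have := HM _ (le_lt_trans st tM) => ? ?.
    exact: is_deriveB.
  have Z (a b : R) : a <= b -> (forall s, a <= s <= b -> `|s| <= `|t|) ->
      (H N - H M) b = (H N - H M) a.
    move=> ab sab.
    have : `|(H N - H M) b - (H N - H M) a| <= cst 0 b - cst 0 a.
      apply: (@is_derive_dist_le _ _ (fun=> 0) (cst 0) (fun=> 0)) => // s abs.
      - exact: D (sab _ abs).
      - by rewrite normr0.
    by rewrite subrr normr_le0 subr_eq0 => /eqP.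
  suff : (H N - H M) t = (H N - H M) 0.
    rewrite !fctE HN0 HM0 subrr => /eqP; by rewrite subr_eq0 => /eqP.
  have [t0|t0] := leP 0 t.
    apply: Z => // s /andP[s0 st]; by rewrite !ger0_norm.
  apply/esym; apply: Z => [|s /andP[st s0]]; first exact: ltW.
  by rewrite !ler0_norm ?lerN2 // ltW.
exists (fun t => H (`|t| + 1) t); split=> [|t].
  have o : 0 < `|0 : R| + 1 by rewrite normr0 add0r.
  by have [] := HP _ o.
(* Every point within distance 1 of [t] has absolute value below [|t| + 2], so on that ball the
   glued function is the single primitive [H (|t| + 2)]. *)
have t2 : `|t| < `|t| + 2 by rewrite ltrDl.
have [_ /(_ t t2) D] := HP (`|t| + 2) (le_lt_trans (normr_ge0 _) t2).
apply: (eq_ball_is_derive ltr01 _ D) => s st.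
apply: HH; last by rewrite ltrDl.
by have := ler_normB s t; have := ler_normD (s - t) t; rewrite subrK; lra.
Qed.

(* Nested intervals [u k - 2 A / 2^k, u k + 2 A / 2^k]. *)
Lemma geometric_cauchy_limit (R : realType) (u : nat -> R) (A : R) :
  (forall k, `|u k.+1 - u k| <= A / 2 ^+ k) ->
  exists l, forall k, `|l - u k| <= 2 * A / 2 ^+ k.
Proof.
move=> uA.
have e2 k : 2 * A / 2 ^+ k = 2 * (2 * A / 2 ^+ k.+1) :> R.
  by rewrite exprS invfM; field; rewrite expf_neq0.
have A2 k : A / 2 ^+ k = 2 * A / 2 ^+ k.+1 :> R.
  by rewrite exprS invfM; field; rewrite expf_neq0.
have lo k m : u k - 2 * A / 2 ^+ k <= u (k + m)%N - 2 * A / 2 ^+ (k + m).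
  elim: m => [|m /le_trans]; first by rewrite addn0.
  apply; rewrite addnS; have := uA (k + m)%N.
  by rewrite A2 (e2 (k + m)%N) ler_norml; lra.
have hi k m : u (k + m)%N + 2 * A / 2 ^+ (k + m) <= u k + 2 * A / 2 ^+ k.
  elim: m => [|m h]; first by rewrite addn0.
  apply: le_trans h; rewrite addnS; have := uA (k + m)%N.
  by rewrite A2 (e2 (k + m)%N) ler_norml; lra.
have A0 : 0 <= A by have := uA 0; rewrite expr0 divr1; apply: le_trans.
have p k : 0 <= 2 * A / 2 ^+ k by rewrite divr_ge0 ?mulr_ge0 ?exprn_ge0.
pose Z := [set u k - 2 * A / 2 ^+ k | k in [set: nat]].
have ub k : ubound Z (u k + 2 * A / 2 ^+ k).
  move=> _ [m _ <-]; have := lo m k; have := hi k m; rewrite addnC.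
  have := p (m + k)%N; lra.
have Z0 : Z !=set0 by exists (u 0 - 2 * A / 2 ^+ 0), 0.
exists (sup Z) => k; rewrite ler_norml.
have : u k - 2 * A / 2 ^+ k <= sup Z.
  by apply: ub_le_sup; [exists (u 0 + 2 * A / 2 ^+ 0); exact: ub|exists k].
have : sup Z <= u k + 2 * A / 2 ^+ k by apply: ge_sup => //; exact: ub.
lra.
Qed.

(** * Global solutions for Lipschitz fields *)

Lemma ler_rV_norm (R : realType) n (v : 'rV[R]_n) (c : R) : 0 <= c ->
  (forall i, `|v 0 i| <= c) -> `|v| <= c.
Proof.
move=> c0 vc; rewrite [leLHS]/Num.Def.normr/= mx_normrE.
by apply: bigmax_le => // -[i j] _; rewrite ord1.
Qed.

Lemma ler_coord_norm (R : realType) n (v : 'rV[R]_n) i : `|v 0 i| <= `|v|.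
Proof.
rewrite [leRHS]/Num.Def.normr/= mx_normrE.
exact: (le_bigmax _ (fun ij => `|v ij.1 ij.2|) (0, i)).
Qed.

Lemma is_derive_rV (R : realType) (V : normedModType R) n (x : V -> 'rV[R]_n)
    (t w : V) (v : 'rV[R]_n) :
  is_derive t w x v <-> forall i, is_derive t w (fun s => x s 0 i) (v 0 i).
Proof.
split=> [[xd <-] i|xd].
  have xid : derivable (fun s => x s 0 i) t w by move/derivable_mxP: xd; apply.
  by split => //; rewrite derive_mx// mxE.
have xd' : derivable x t w by apply/derivable_mxP => i j; rewrite ord1; case: (xd j).
split=> //; apply/rowP => i; rewrite derive_mx// mxE; exact: derive_val.
Qed.

Lemma is_derive_compN (R : realType) n (x : R -> 'rV[R]_n) (t : R) v :
  is_derive (- t) 1 x v -> is_derive t 1 (fun s => x (- s)) (- v).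
Proof.
move=> /is_derive_rV xv; apply/is_derive_rV => i.
have := xv i => ?; rewrite mxE -mulrN1.
exact: (@is_derive1_comp _ (fun s => x s 0 i) -%R).
Qed.

(** For positive times [C * expR (K * t)] is a majorant in [is_derive_dist_le]; negative times
    follow by reflection. Integration thus gains a factor [1 / K] against the weight
    [expR (K * |t|)]. *)
Lemma is_derive_exp_le (R : realType) (q dq : R -> R) (K C : R) : 0 <= C ->
  (forall s : R, is_derive s 1 q (dq s)) -> q 0 = 0 ->
  (forall s, `|dq s| <= C * K * expR (K * `|s|)) ->
  forall t, `|q t| <= C * expR (K * `|t|).
Proof.
move=> C0 + + + t; wlog t0 : q dq t / 0 <= t => [H qE q0 dqK|].
  have [t0|t0] := leP 0 t; first exact: (H q dq).
  have := H (q \o -%R) (fun s => - dq (- s)) (- t).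
  rewrite /= opprK normrN; apply.
  - by rewrite oppr_ge0 ltW.
  - move=> s; have := qE (- s) => ?; rewrite -mulrN1; exact: is_derive1_comp.
  - by rewrite oppr0.
  - by move=> s; rewrite normrN (le_trans (dqK _))// normrN.
move=> qE q0 dqK.
have : `|q t - q 0| <= C * expR (K * t) - C * expR (K * 0).
  apply: (@is_derive_dist_le _ q dq
    (fun s => C * expR (K * s)) (fun s => C * (K * expR (K * s)))) => //.
    move=> s _; have := is_derive_expRM K s => ?; exact: is_deriveZ.
  by move=> s /andP[/ltW s0 _]; rewrite (le_trans (dqK _))// ger0_norm// mulrA.
rewrite q0 subr0 mulr0 expR0 mulr1 (ger0_norm t0); lra.
Qed.

(** * Picard iteration on the whole line in an exponentially weighted norm *)

Section Picard.
Context (R : realType) (n : nat) (F : 'rV[R]_n -> 'rV[R]_n) (L : R).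
Hypothesis L0 : 0 < L.
Hypothesis FL : forall x y, `|F x - F y| <= L * `|x - y|.
Context (x0 : 'rV[R]_n).
Implicit Types x y : R -> 'rV[R]_n.

Let F_continuous : continuous F.
Proof.
move=> x; apply/continuous_normP => e e0.
exists (e / L) => [|y yx]; first by rewrite divr_gt0.
by apply: le_lt_trans (FL _ _) _; rewrite mulrC -ltr_pdivlMr.
Qed.

Let Fx_continuous x i : continuous x -> continuous (fun s => F (x s) 0 i).
Proof.
move=> cx s; apply: (@continuous_comp _ _ _ (F \o x) (fun v => v 0 i)).
  by apply: continuous_comp; [exact: cx|exact: F_continuous].
exact: coord_continuous.
Qed.

(** [get] makes this total; it is known to be a primitive only for continuous [g], which is why
    continuity of the iterates is carried along. *)
Let primitive (g : R -> R) : R -> R :=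
  get [set G | G 0 = 0 /\ forall t : R, is_derive t 1 G (g t)].

Let primitiveP (g : R -> R) : continuous g ->
  primitive g 0 = 0 /\ forall t : R, is_derive t 1 (primitive g) (g t).
Proof.
move=> /exists_primitive[G GP]; rewrite /primitive; set P := mkset _.
exact: (@getPex _ P (ex_intro _ G GP)).
Qed.

Let picard x t := x0 + \row_i primitive (fun s => F (x s) 0 i) t.

Let picard0 x : continuous x -> picard x 0 = x0.
Proof.
move=> cx; apply/rowP => i; rewrite !mxE.
by have [-> _] := primitiveP (@Fx_continuous _ i cx); rewrite addr0.
Qed.

Let picardE x (t : R) : continuous x -> is_derive t 1 (picard x) (F (x t)).
Proof.
move=> cx; apply/is_derive_rV => i.
have [_ /(_ t) D] := primitiveP (@Fx_continuous _ i cx).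
rewrite -[F _ _ _]add0r; under eq_fun do rewrite !mxE.
exact: is_deriveD.
Qed.

Let picard_continuous x : continuous x -> continuous (picard x).
Proof. by move=> cx t; exact: is_derive_continuous (picardE t cx). Qed.

(** With the weight [expR (K * |t|)] the Lipschitz constant costs [L] and integration gains [1 / K],
    so this choice gives a contraction of ratio 1/2 for all times at once. *)
Let K := 2 * L.

Let picard_contraction x y C : 0 <= C -> continuous x -> continuous y ->
  (forall t, `|x t - y t| <= C * expR (K * `|t|)) ->
  forall t, `|picard x t - picard y t| <= C / 2 * expR (K * `|t|).
Proof.
move=> C0 cx cy xy t; have C20 : 0 <= C / 2 by rewrite divr_ge0.
apply: ler_rV_norm => [|i]; first by rewrite mulr_ge0 ?expR_ge0.
rewrite !mxE.
have [px0 px] := primitiveP (@Fx_continuous _ i cx).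
have [py0 py] := primitiveP (@Fx_continuous _ i cy).
rewrite opprD addrACA subrr add0r.
apply: (@is_derive_exp_le _ (primitive _ - primitive _)
  (fun s => F (x s) 0 i - F (y s) 0 i)) => //.
- by rewrite !fctE px0 py0 subrr.
move=> s; rewrite (_ : _ - _ = (F (x s) - F (y s)) 0 i); last by rewrite !mxE.
rewrite (le_trans (ler_coord_norm _ _))// (le_trans (FL _ _))//.
rewrite (_ : _ / 2 * K = L * C); last by rewrite /K; field.
by rewrite -mulrA ler_wpM2l// ltW.
Qed.

Let X k := iter k picard (cst x0).

Let X_continuous k : continuous (X k).
Proof.
by elim: k => [|k IH]; [exact: cst_continuous|exact: picard_continuous].
Qed.

(** Chosen so that [M * K] is [|F x0|], the speed of the first iterate; this starts the geometric
    estimate. *)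
Let M := `|F x0| / K.

Let M0 : 0 <= M. Proof. by rewrite divr_ge0// mulr_ge0// ltW. Qed.

Let X_step k t : `|X k.+1 t - X k t| <= M * expR (K * `|t|) / 2 ^+ k.
Proof.
rewrite mulrAC; elim: k t => [|k IH] t; last first.
  rewrite exprS invfM [2^-1 * _]mulrC mulrA.
  have C0 : 0 <= M / 2 ^+ k by rewrite divr_ge0 ?exprn_ge0.
  exact: (picard_contraction C0 (@X_continuous k.+1) (@X_continuous k)).
rewrite expr0 divr1 /= addrC addKr; apply: ler_rV_norm => [|i].
  by rewrite mulr_ge0 ?expR_ge0.
have [p0 pE] := primitiveP (@Fx_continuous _ i (@cst_continuous _ _ x0)).
rewrite mxE; apply: (is_derive_exp_le M0 pE p0) => s.
rewrite divfK ?mulf_neq0 ?gt_eqF// (le_trans (ler_coord_norm _ _))//.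
by rewrite ler_peMr// -expR0 ler_expR mulr_ge0// mulr_ge0// ltW.
Qed.

Theorem picard_lindelof :
  exists y : R -> 'rV[R]_n, y 0 = x0 /\ forall t : R, is_derive t 1 y (F (y t)).
Proof.
have lim t i : exists l, forall k,
    `|l - X k t 0 i| <= 2 * (M * expR (K * `|t|)) / 2 ^+ k.
  apply: geometric_cauchy_limit => k; apply: le_trans (X_step k t).
  by rewrite (le_trans _ (ler_coord_norm _ i))// !mxE.
pose y t := \row_i sval (cid (lim t i)).
have yX k t : `|y t - X k t| <= 2 * M / 2 ^+ k * expR (K * `|t|).
  have -> : 2 * M / 2 ^+ k * expR (K * `|t|) = 2 * (M * expR (K * `|t|)) / 2 ^+ k.
    by rewrite mulrAC !mulrA.
  apply: ler_rV_norm => [|i].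
    by rewrite divr_ge0 ?exprn_ge0// mulr_ge0// mulr_ge0 ?expR_ge0.
  by rewrite !mxE; exact: (svalP (cid (lim t i))).
have small (C e : R) : 0 < e -> exists k, C / 2 ^+ k < e.
  move=> e0; have [k kC] : exists k : nat, C / e < k%:R.
    by exists (Num.truncn (C / e)).+1; exact: truncnS_gt.
  exists k; rewrite ltr_pdivrMr ?exprn_gt0// -ltr_pdivrMl// mulrC.
  rewrite (lt_le_trans kC)// -natrX ler_nat; exact/ltnW/ltn_expl.
(* The convergence is uniform on [|s - t| < 1], where the weight is at most [expR (K * (|t| + 1))],
   so three thirds of [e] suffice. *)
have cy : continuous y.
  move=> t; apply/continuous_normP => e e0.
  have [k kC] := small (2 * M * expR (K * (`|t| + 1))) (e / 3) ltac:(lra).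
  have yXs s : `|s - t| < 1 -> `|y s - X k s| < e / 3.
    move=> st; apply: le_lt_trans (yX k s) _; apply: le_lt_trans kC.
    rewrite [leLHS]mulrAC; apply: ler_wpM2r; first by rewrite invr_ge0 exprn_ge0.
    apply: ler_wpM2l; first by rewrite mulr_ge0.
    rewrite ler_expR; apply: ler_wpM2l; first by rewrite mulr_ge0 ?(ltW L0).
    by have := ler_normD (s - t) t; rewrite subrK; lra.
  have /continuous_normP/(_ (e / 3) ltac:(lra))[r r0 Xt] := @X_continuous k t.
  exists (Num.min r 1) => [|s]; first by rewrite lt_min r0 ltr01.
  rewrite lt_min => /andP[str st].
  have tt : `|t - t| < 1 by rewrite subrr normr0.
  have := Xt _ str; have := yXs _ st; have := yXs _ tt.
  have := ler_distD (X k s) (y s) (y t); have := ler_distD (X k t) (X k s) (y t).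
  by rewrite (distrC (X k t) (y t)); lra.
(* Both sides are within a multiple of [2^-k] of the iterate [X k.+1], the right one by the
   contraction estimate applied to [y] and [X k]. *)
have yP t : y t = picard y t.
  apply/eqP; rewrite -subr_eq0 -normr_le0; apply/ler_addgt0Pr => e e0.
  rewrite add0r.
  have [k /ltW kC] := small (2 * M * expR (K * `|t|)) e e0; apply: le_trans kC.
  have C0 : 0 <= 2 * M / 2 ^+ k.
    by apply: divr_ge0; [apply: mulr_ge0; [exact: ler0n|exact: M0]|exact: exprn_ge0].
  have h1 := picard_contraction C0 cy (@X_continuous k) (yX k) t.
  have h2 := yX k.+1 t.
  apply: le_trans (ler_distD (X k.+1 t) _ _) _; rewrite [X in _ + X]distrC.
  apply: le_trans (lerD h2 h1) _.
  by rewrite le_eqVlt; apply/orP; left; apply/eqP; rewrite exprS; field;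
    rewrite expf_neq0.
exists y; split=> [|t]; first by rewrite yP picard0.
have -> : y = picard y by apply/funext.
by rewrite -[in F _]yP; exact: picardE.
Qed.

End Picard.

(** * Maximal solutions *)

(** One Lipschitz constant per ball: unlike a global constant, this survives products, hence covers
    polynomial fields, and it is enough for uniqueness and for the truncated fields. *)
Definition lipschitz_on_bounded (R : realType) (V W : normedModType R) (f : V -> W) :=
  forall M : R, exists2 L : R, 0 < L &
    forall x y, `|x| <= M -> `|y| <= M -> `|f x - f y| <= L * `|x - y|.

Lemma openP_norm (R : realType) (V : normedModType R) (A : set V) :
  open A <-> forall x, A x -> exists2 r : R, 0 < r & forall y, `|y - x| < r -> A y.
Proof.
by rewrite openE; split=> H x /H; [move/near_normP|move=> ?; apply/near_normP].
Qed.

(** Gronwall for the sum [w] of the squared coordinate differences, which is differentiable where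
    the sup norm need not be. Each of the [n] summands has derivative at most [2 * L * w]. *)
Lemma lipschitz_solution_unique (R : realType) n (F : 'rV[R]_n -> 'rV[R]_n)
    (L T : R) (x y : R -> 'rV[R]_n) : 0 < L -> 0 <= T ->
  (forall s, 0 < s < T -> `|F (x s) - F (y s)| <= L * `|x s - y s|) ->
  (forall s, 0 <= s <= T -> is_derive s 1 x (F (x s))) ->
  (forall s, 0 <= s <= T -> is_derive s 1 y (F (y s))) ->
  x 0 = y 0 -> x T = y T.
Proof.
move=> L0 T0 FL xE yE xy0.
pose D i s := x s 0 i - y s 0 i.
pose w := \sum_(i < n) (D i) ^+ 2.
pose dw s := \sum_(i < n) (2 * D i s) * (F (x s) 0 i - F (y s) 0 i).
have wE s : w s = \sum_(i < n) (D i s) ^+ 2.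
  by rewrite /w fct_sumE; apply: eq_bigr => i _; rewrite fctE.
have w0 s : 0 <= w s by rewrite wE sumr_ge0// => i _; rewrite sqr_ge0.
have Dw s i : `|D i s| <= Num.sqrt (w s).
  rewrite -sqrtr_sqr ler_wsqrtr// wE (bigD1 i)//= lerDl sumr_ge0// => j _.
  by rewrite sqr_ge0.
have xyw s : `|x s - y s| <= Num.sqrt (w s).
  by apply: ler_rV_norm => [|i]; [exact: sqrtr_ge0|rewrite !mxE; exact: Dw].
have : w T <= w 0 * expR (n%:R * (2 * L) * T).
  apply: (@gronwall _ w dw) => // s sT.
    apply: is_derive_eq.
      apply: is_derive_sum => i; apply: is_deriveX; apply: is_deriveB.
        by have /is_derive_rV := xE _ sT; apply.
      by have /is_derive_rV := yE _ sT; apply.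
    by apply: eq_bigr => i _; rewrite expr1.
  rewrite -mulrA mulr_natl -[X in _ *+ X]card_ord -sumr_const.
  apply: ler_sum => i _; apply: le_trans (ler_norm _) _.
  rewrite 2!normrM -!mulrA ger0_norm// ler_pM2l// mulrC.
  rewrite -[X in _ <= L * X]sqr_sqrtr// expr2 mulrA.
  apply: ler_pM => //.
  have -> : F (x s) 0 i - F (y s) 0 i = (F (x s) - F (y s)) 0 i by rewrite !mxE.
  apply: le_trans (ler_coord_norm _ _) _; apply: le_trans (FL _ sT) _.
  by rewrite ler_pM2l.
have -> : w 0 = 0.
  by rewrite wE big1// => i _; rewrite /D xy0 subrr expr0n.
rewrite mul0r => wT.
have {}wT : w T = 0 by apply/eqP; rewrite eq_le wT w0.
by apply/eqP; rewrite -subr_eq0 -normr_le0 (le_trans (xyw T))// wT sqrtr0.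
Qed.

(** * Truncation onto a cube, nonexpansive for the sup norm *)

Section Clamp.
Context (R : realType) (n : nat).

Definition clamp (M : R) (x : 'rV[R]_n) : 'rV[R]_n :=
  \row_i Num.max (- M) (Num.min M (x 0 i)).

Lemma norm_clamp M x : 0 <= M -> `|clamp M x| <= M.
Proof.
move=> M0; apply: ler_rV_norm => // i; rewrite mxE ler_norml le_max lexx/=.
by rewrite ge_max ge_min lexx andbT ge0_cp.
Qed.

Lemma clamp_id M x : `|x| <= M -> clamp M x = x.
Proof.
move=> xM; apply/rowP => i; rewrite mxE.
have := le_trans (ler_coord_norm x i) xM; rewrite ler_norml => /andP[h1 h2].
by rewrite (min_idPr h2) (max_idPr h1).
Qed.

Lemma clamp_lipschitz M x y : `|clamp M x - clamp M y| <= `|x - y|.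
Proof.
apply: ler_rV_norm => // i; apply: le_trans (ler_coord_norm _ i); rewrite !mxE.
move: (x 0 i) (y 0 i) => a b.
have dist_max c (u v : R) : `|Num.max c u - Num.max c v| <= `|u - v|.
  (* Replacing the right-hand bound by a variable [d] leaves only bounds of the form [|z| <= d],
     which open into linear inequalities. *)
  have : `|u - v| <= `|u - v| by [].
  move: {2 3}`|u - v| => d; rewrite 2!ler_norml => /andP[h1 h2].
  by apply/andP; split; case: (ltP c u) => ?; case: (ltP c v) => ?; lra.
have dist_min c (u v : R) : `|Num.min c u - Num.min c v| <= `|u - v|.
  have : `|u - v| <= `|u - v| by [].
  move: {2 3}`|u - v| => d; rewrite 2!ler_norml => /andP[h1 h2].
  by apply/andP; split; case: (ltP c u) => ?; case: (ltP c v) => ?; lra.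
exact: le_trans (dist_max _ _ _) (dist_min _ _ _).
Qed.

End Clamp.

Section Solutions.
Context (R : realType) (n : nat).
Implicit Types (f : 'rV[R]_n -> 'rV[R]_n) (x y : R -> 'rV[R]_n) (J : set R).

Lemma clamp_solution f (M : R) (x0 : 'rV[R]_n) : lipschitz_on_bounded f -> 0 <= M ->
  exists y, y 0 = x0 /\ forall t : R, is_derive t 1 y (f (clamp M (y t))).
Proof.
move=> /(_ M)[L L0 fL] M0; apply: (@picard_lindelof _ _ (f \o clamp M) L) => // x y.
by rewrite (le_trans (fL _ _ _ _)) ?norm_clamp// ler_pM2l// clamp_lipschitz.
Qed.

Lemma time_reversedK f : time_reversed (time_reversed f) = f.
Proof. by apply/funext => X; rewrite /time_reversed opprK. Qed.

Lemma lipschitz_on_bounded_reversed f :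
  lipschitz_on_bounded f -> lipschitz_on_bounded (time_reversed f).
Proof.
move=> fL M; have [L L0 H] := fL M; exists L => // x y xM yM.
by rewrite -opprD normrN H.
Qed.

Lemma solution_reversed f J x : solution f J x ->
  solution (time_reversed f) [set t | J (- t)] (fun t => x (- t)).
Proof.
move=> [/openP_norm oJ iJ J0 xE]; split => /=.
- apply/openP_norm => t /oJ[r r0 rJ]; exists r => // s st; apply: rJ.
  by rewrite -opprD normrN.
- move=> a b Ja Jb c /andP[ac cb]; apply: (iJ _ _ Jb Ja).
  by rewrite !lerN2 ac cb.
- by rewrite oppr0.
- by move=> t Jt; apply: is_derive_compN; exact: xE.
Qed.

Lemma maximal_solution_reversed f J x : maximal_solution f J x ->
  maximal_solution (time_reversed f) [set t | J (- t)] (fun t => x (- t)).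
Proof.
move=> [xJ xmax]; split=> [|J' y yJ' JJ' yx t J't /=]; first exact: solution_reversed.
have := solution_reversed yJ'; rewrite time_reversedK => /xmax; apply => /=.
- by move=> s Js; apply: JJ'; rewrite /= opprK.
- by move=> s Js; rewrite yx ?opprK//= opprK.
- by rewrite opprK.
Qed.

Lemma solution_bounded f J x (T : R) : solution f J x -> 0 <= T -> J T ->
  exists M, forall s, 0 <= s <= T -> `|x s| <= M.
Proof.
move=> [_ iJ J0 xE] T0 JT.
have [|c _ cP] := @EVT_max _ (fun s => `|x s|) _ _ T0.
  apply: continuous_in_subspaceT => s; rewrite inE/= in_itv/= => sT.
  apply: continuous_comp; last exact: norm_continuous.
  by apply: (is_derive_continuous (xE s _)); exact: iJ J0 JT _ sT.
by exists `|x c| => s sT; apply: cP; rewrite in_itv.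
Qed.

Lemma solution_unique_ge0 f J1 J2 x y : lipschitz_on_bounded f ->
  solution f J1 x -> solution f J2 y -> x 0 = y 0 ->
  forall t, 0 <= t -> J1 t -> J2 t -> x t = y t.
Proof.
move=> fL xJ yJ xy0 t t0 Jx Jy.
have [M1 xM] := solution_bounded xJ t0 Jx.
have [M2 yM] := solution_bounded yJ t0 Jy.
have [L L0 H] := fL (Num.max M1 M2).
case: xJ yJ => _ i1 x0 xE [_ i2 y0 yE].
apply: (@lipschitz_solution_unique _ _ f L) => // s st.
- have st' : 0 <= s <= t by case/andP: st => /ltW-> /ltW->.
  by apply: H; rewrite le_max ?xM ?yM ?orbT.
- by apply: xE; exact: (i1 _ _ x0 Jx).
- by apply: yE; exact: (i2 _ _ y0 Jy).
Qed.

Lemma solution_unique f J1 J2 x y : lipschitz_on_bounded f ->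
  solution f J1 x -> solution f J2 y -> x 0 = y 0 ->
  forall t, J1 t -> J2 t -> x t = y t.
Proof.
move=> fL xJ yJ xy0 t Jx Jy.
have [t0|t0] := leP 0 t; first exact: (solution_unique_ge0 fL xJ yJ).
have := solution_unique_ge0 (lipschitz_on_bounded_reversed fL)
  (solution_reversed xJ) (solution_reversed yJ).
rewrite /= !oppr0 => /(_ xy0 (- t)); rewrite !opprK; apply => //.
by rewrite oppr_ge0 ltW.
Qed.

(** The solution of the field truncated at radius [|x0| + 1] stays in that cube for a short time by
    continuity, and there the truncation is the identity. *)
Lemma exists_local_solution f (x0 : 'rV[R]_n) : lipschitz_on_bounded f ->
  exists J y, solution f J y /\ y 0 = x0.
Proof.
move=> fL; have M0 : 0 <= `|x0| + 1 by rewrite addr_ge0.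
have [y [y0 yE]] := clamp_solution x0 fL M0.
have /continuous_normP/(_ 1 ltr01)[r r0 yr] := is_derive_continuous (yE 0).
exists [set t | `|t| < r], y; split => //; split.
- apply/openP_norm => t /= tr; exists (r - `|t|); first by rewrite subr_gt0.
  by move=> s st; have := ler_normD (s - t) t; rewrite subrK; lra.
- move=> a b /=; rewrite !ltr_norml => ha hb c hc; rewrite ltr_norml; lra.
- by rewrite /= normr0.
- move=> t /= tr; have := yE t; rewrite clamp_id//.
  have := yr t; rewrite subr0 => /(_ tr); rewrite y0.
  by have := ler_normD (y t - x0) x0; rewrite subrK; lra.
Qed.

(** By uniqueness all solutions through [x0] agree where they are defined, so they glue to one
    solution on the union [Jm] of their intervals, which contains every competitor. *)
Lemma exists_maximal_solution f (x0 : 'rV[R]_n) : lipschitz_on_bounded f ->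
  exists J x, maximal_solution f J x /\ x 0 = x0.
Proof.
move=> fL.
pose Jm := [set t | exists J y, [/\ solution f J y, y 0 = x0 & J t]].
have val t : exists v, forall J y, solution f J y -> y 0 = x0 -> J t -> y t = v.
  have [[J [y [yJ y0 Jt]]]|no] := pselect (Jm t).
    exists (y t) => J' z zJ' z0 J't.
    by apply: (solution_unique fL zJ' yJ) => //; rewrite z0.
  by exists 0 => J y yJ y0 Jt; case: no; exists J, y.
pose x t := sval (cid (val t)).
have xE J y t : solution f J y -> y 0 = x0 -> J t -> y t = x t.
  by move=> yJ y0 Jt; exact: (svalP (cid (val t)) J y).
have [J0 [y [yJ y0]]] := exists_local_solution x0 fL.
have J00 : J0 0 by case: yJ.
have x00 : x 0 = x0 by rewrite -(xE J0 y).
exists Jm, x; split => //; split; first split.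
- apply/openP_norm => t [J [z [zJ z0 Jt]]].
  case: (zJ) => /openP_norm/(_ _ Jt)[r r0 rJ] _ _ _.
  by exists r => // s /rJ Js; exists J, z.
- move=> a b [J [z [zJ z0 Ja]]] [J' [z' [zJ' z0' Jb]]] c /andP[ac cb].
  have [c0|c0] := leP 0 c.
    exists J', z'; split=> //; case: (zJ') => _ iJ' J'0 _.
    by apply: (iJ' _ _ J'0 Jb); rewrite c0 cb.
  exists J, z; split=> //; case: (zJ) => _ iJ J'0 _.
  by apply: (iJ _ _ Ja J'0); rewrite ac ltW.
- by exists J0, y.
- move=> t [J [z [zJ z0 Jt]]].
  case: (zJ) => /openP_norm/(_ _ Jt)[r r0 rJ] _ _ zE.
  rewrite -(xE J z)//; apply: (eq_ball_is_derive r0 _ (zE _ Jt)) => s /rJ Js.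
  exact: (xE J).
- move=> J' z zJ' JJ' zx t J't; exists J', z; split=> //.
  by rewrite zx//; exists J0, y.
Qed.

(** If [J] had a finite supremum [T], the solution [y] of the field truncated at [M + 1] would agree
    with [x] on [0, T) and pass through [T] with norm at most [M]. Near [T] it still solves the
    original field, so it would extend [x] past [T]. *)
Lemma bounded_maximal_solution f J x (M : R) : lipschitz_on_bounded f ->
  maximal_solution f J x -> (forall t, J t -> 0 <= t -> `|x t| <= M) ->
  forall t, 0 <= t -> J t.
Proof.
move=> fL [[/openP_norm oJ iJ J0 xE] xmax] xM t0 t0_ge0; apply: contrapT => nJ.
have M0 : 0 <= M by apply: le_trans (xM 0 J0 (lexx _)).
have M1 : 0 <= M + 1 by rewrite addr_ge0.
have [y [y0 yE]] := clamp_solution (x 0) fL M1.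
have xy s : J s -> 0 <= s -> x s = y s.
  move=> Js s0; have [L L0 H] := fL (M + 1).
  apply: (@lipschitz_solution_unique _ _ (f \o clamp (M + 1)) L) => // u us.
  - rewrite (le_trans (H _ _ _ _)) ?norm_clamp// ler_pM2l//.
    exact: clamp_lipschitz.
  - have Ju : J u by exact: iJ J0 Js _ us.
    rewrite /= clamp_id; first exact: xE.
    by rewrite (le_trans (xM _ Ju _)) ?lerDl//; case/andP: us.
pose T := sup J.
have Jt0 s : J s -> s < t0.
  move=> Js; rewrite ltNge; apply/negP => t0s; apply: nJ.
  by apply: (iJ _ _ J0 Js); rewrite t0_ge0.
have supJ : has_sup J.
  by split; [exists 0|exists t0 => s /Jt0/ltW].
have JT s : J s -> s < T.
  move=> Js; have [r r0 rJ] := oJ _ Js.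
  suff : s + r / 2 <= T by lra.
  apply: ub_le_sup; first by case: supJ.
  by apply: rJ; rewrite addrC addKr ger0_norm; lra.
have TJ s : 0 <= s -> s < T -> J s.
  move=> s0 sT; have [u Ju su] := sup_gt (ex_intro _ 0 J0) sT.
  by apply: (iJ _ _ J0 Ju); rewrite s0 ltW.
have T0 : 0 < T by exact: JT.
have nJT : ~ J T by move=> /JT; rewrite ltxx.
have yT : `|y T| <= M.
  rewrite leNgt; apply/negP => MyT.
  have /continuous_normP/(_ (`|y T| - M)) := is_derive_continuous (yE T).
  rewrite subr_gt0 => /(_ MyT)[r r0 yr].
  (* A time before [T], close enough for the continuity estimate and still nonnegative, where [y s]
     is [x s] and so bounded by [M]. *)
  pose s := T - Num.min (r / 2) T.
  have [m0 [mT mr]] : 0 < Num.min (r / 2) T /\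
      Num.min (r / 2) T <= T /\ Num.min (r / 2) T <= r / 2.
    by do !split; rewrite ?lt_min ?ge_min ?lexx ?orbT// T0 divr_gt0.
  have s0 : 0 <= s by rewrite /s; lra.
  have sT : s < T by rewrite /s; lra.
  have := yr s; rewrite {1}/s addrC addKr normrN gtr0_norm// => /(_ ltac:(lra)).
  have := xM s (TJ _ s0 sT) s0; rewrite (xy _ (TJ _ s0 sT) s0).
  by have := ler_distD (y s) (y T) 0; rewrite !subr0 distrC; lra.
have /continuous_normP/(_ 1 ltr01)[r' r'0 yr'] := is_derive_continuous (yE T).
(* The bound by [T] keeps the ball around [T] inside positive times, where [x] and [y] are known to
   agree before [T]. *)
pose r := Num.min r' T.
have [r0 [rT rr']] : 0 < r /\ r <= T /\ r <= r'.
  by do !split; rewrite ?lt_min ?ge_min ?lexx ?orbT// T0 r'0.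
have yr s : `|s - T| < r -> `|y s| <= M + 1.
  move=> sT; have := yr' s (lt_le_trans sT rr').
  by have := ler_normD (y s - y T) (y T); rewrite subrK; lra.
have ball_gt0 s : `|s - T| < r -> 0 < s by rewrite ltr_norml; lra.
(* Using [x] up to [T] retains the negative times, on which [y] has not been compared with [x]. *)
pose z s := if s < T then x s else y s.
have zx s : s < T -> z s = x s by rewrite /z => ->.
have zy s : 0 <= s -> z s = y s.
  by rewrite /z; case: ltP => // sT s0; rewrite (xy _ (TJ _ s0 sT)).
have := xmax (J `|` [set s | `|s - T| < r]) z.
move=> /(_ _ _ _ T) h; apply: nJT; apply: h => /=; last first.
- by right; rewrite subrr normr0.
- by move=> s /JT; exact: zx.
- by move=> s Js; left.
split.
- apply: openU; apply/openP_norm; first exact: oJ.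
  move=> s /= sr; exists (r - `|s - T|); first by rewrite subr_gt0.
  move=> u us; have := ler_normD (u - s) (s - T).
  by rewrite addrA subrK; lra.
- move=> a b Ja Jb c /andP[ac cb].
  have [cT|Tc] := ltP c T.
    have [c0|c0] := leP 0 c; first by left; exact: TJ.
    case: Ja => [Ja|/ball_gt0]; last lra.
    by left; apply: (iJ _ _ Ja J0); rewrite ac ltW.
  case: Jb => [/JT|/=]; first lra.
  by move=> bT; right => /=; move: bT; rewrite !ltr_norml; lra.
- by left.
- move=> s Js; have [sT|Ts] := ltP s T.
    have {}Js : J s by case: Js => // /ball_gt0/ltW s0; exact: TJ.
    rewrite zx//; apply: (@eq_ball_is_derive _ _ x _ _ (T - s)) (xE _ Js).
      by rewrite subr_gt0.
    by move=> u; rewrite ltr_norml => ?; rewrite zx//; lra.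
  have {Js} sr : `|s - T| < r by case: Js => // /JT; lra.
  have s0 := ball_gt0 _ sr.
  rewrite zy ?ltW//; have := yE s; rewrite clamp_id ?yr//.
  apply: (@eq_ball_is_derive _ _ y _ _ s) => // u.
  by rewrite ltr_norml => us; rewrite zy//; lra.
Qed.

End Solutions.

(** * The vector field and its energy *)

Section LipschitzOnBounded.
Context (R : realType) (V : normedModType R).
Implicit Types f g : V -> R.

Lemma lipschitz_on_bounded_le f (M : R) : lipschitz_on_bounded f ->
  exists2 B, 0 < B & forall x, `|x| <= M -> `|f x| <= B.
Proof.
have [M0|M0] := leP 0 M; last first.
  by move=> _; exists 1 => // x xM; have := normr_ge0 x; lra.
move=> /(_ M)[L L0 fL].
exists (`|f 0| + L * M + 1) => [|x xM].
  by rewrite ltr_wpDl// addr_ge0// mulr_ge0// ltW.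
have := fL x 0 xM; rewrite normr0 subr0 => /(_ M0) fx.
have : L * `|x| <= L * M by rewrite ler_pM2l.
by have := ler_normD (f x - f 0) (f 0); rewrite subrK; lra.
Qed.

Lemma lipschitz_on_bounded_near f p (e : R) :
  lipschitz_on_bounded f -> 0 < e ->
  \forall x \near p, `|f x - f p| < e.
Proof.
move=> /(_ (`|p| + 1))[L L0 fL] e0; apply/near_normP.
exists (Num.min 1 (e / L)) => [|x]; first by rewrite lt_min ltr01 divr_gt0.
rewrite lt_min => /andP[x1 xe]; apply: le_lt_trans (fL _ _ _ _) _.
- by have := ler_normD (x - p) p; rewrite subrK; lra.
- by rewrite lerDl.
- by rewrite mulrC -ltr_pdivlMr.
Qed.

Lemma lipschitz_on_bounded_cst (c : R) : lipschitz_on_bounded (fun _ : V => c).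
Proof. by move=> M; exists 1 => // x y _ _; rewrite subrr normr0 mul1r. Qed.

Lemma lipschitz_on_boundedD f g : lipschitz_on_bounded f ->
  lipschitz_on_bounded g -> lipschitz_on_bounded (fun x => f x + g x).
Proof.
move=> fL gL M; have [L L0 {}fL] := fL M; have [N N0 {}gL] := gL M.
exists (L + N) => [|x y xM yM]; first by rewrite addr_gt0.
rewrite opprD addrACA mulrDl; apply: le_trans (ler_normD _ _) _.
by apply: lerD; [exact: fL|exact: gL].
Qed.

Lemma lipschitz_on_boundedN f : lipschitz_on_bounded f ->
  lipschitz_on_bounded (fun x => - f x).
Proof.
move=> fL M; have [L L0 {}fL] := fL M; exists L => // x y xM yM.
by rewrite -opprD normrN fL.
Qed.

Lemma lipschitz_on_boundedM f g : lipschitz_on_bounded f ->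
  lipschitz_on_bounded g -> lipschitz_on_bounded (fun x => f x * g x).
Proof.
move=> fL gL M; have [A A0 fA] := lipschitz_on_bounded_le M fL.
have [B B0 gB] := lipschitz_on_bounded_le M gL.
have [L L0 {}fL] := fL M; have [N N0 {}gL] := gL M.
exists (A * N + B * L) => [|x y xM yM]; first by rewrite addr_gt0 ?mulr_gt0.
have -> : f x * g x - f y * g y = f x * (g x - g y) + g y * (f x - f y) by ring.
apply: le_trans (ler_normD _ _) _; rewrite mulrDl !normrM -!mulrA.
by apply: lerD; apply: ler_pM => //; [exact: fA|exact: gL|exact: gB|exact: fL].
Qed.

Lemma lipschitz_on_boundedX f n : lipschitz_on_bounded f ->
  lipschitz_on_bounded (fun x => f x ^+ n).
Proof.
move=> fL; elim: n => [|n IH]; first exact: lipschitz_on_bounded_cst.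
by under eq_fun do rewrite exprS; exact: lipschitz_on_boundedM.
Qed.

End LipschitzOnBounded.

Lemma lipschitz_on_bounded_coord (R : realType) n (i : 'I_n) :
  lipschitz_on_bounded (fun x : 'rV[R]_n => x 0 i).
Proof.
move=> M; exists 1 => // x y _ _; rewrite mul1r.
by apply: le_trans (ler_coord_norm _ i); rewrite !mxE.
Qed.

Lemma lipschitz_on_bounded_rV (R : realType) (V : normedModType R) n
    (f : V -> 'rV[R]_n) :
  (forall i, lipschitz_on_bounded (fun x => f x 0 i)) -> lipschitz_on_bounded f.
Proof.
move=> fL M.
have L i : exists L, 0 < L /\ forall x y, `|x| <= M -> `|y| <= M ->
    `|f x 0 i - f y 0 i| <= L * `|x - y|.
  by have [L L0 H] := fL i M; exists L.
pose l i := sval (cid (L i)).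
have l0 i : 0 < l i by case: (svalP (cid (L i))).
have lP i x y : `|x| <= M -> `|y| <= M -> `|f x 0 i - f y 0 i| <= l i * `|x - y|.
  by case: (svalP (cid (L i))) => _; apply.
(* The sum dominates each coordinate constant; the 1 keeps it positive even when [n] is 0. *)
exists (1 + \sum_i l i) => [|x y xM yM].
  by rewrite ltr_pwDl// sumr_ge0// => i _; exact: ltW.
have s0 : 0 <= \sum_i l i by apply: sumr_ge0 => i _; exact: ltW.
apply: ler_rV_norm => [|i]; first by rewrite mulr_ge0// addr_ge0.
rewrite !mxE; apply: le_trans (lP i _ _ xM yM) _; apply: ler_wpM2r => //.
rewrite (bigD1 i)//= addrCA lerDl addr_ge0// sumr_ge0// => j _; exact: ltW.
Qed.

Ltac lipschitz_on_bounded_tac :=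
  repeat first
    [ apply: lipschitz_on_bounded_cst | apply: lipschitz_on_bounded_coord
    | apply: lipschitz_on_boundedD | apply: lipschitz_on_boundedN
    | apply: lipschitz_on_boundedX | apply: lipschitz_on_boundedM ].

Section System.
Context (R : realType).
Implicit Types (lambda : R) (X : 'rV[R]_3).

Definition energy X : R := 3 * Scoord X ^+ 2 + 3 / 2 * Pcoord X ^+ 2 - 1.

Local Notation r3 := (Num.sqrt 3 : R).

Lemma Scoord_vec3 (S U P : R) : Scoord (vec3 S U P) = S.
Proof. by rewrite /Scoord !mxE. Qed.

Lemma Ucoord_vec3 (S U P : R) : Ucoord (vec3 S U P) = U.
Proof. by rewrite /Ucoord !mxE. Qed.

Lemma Pcoord_vec3 (S U P : R) : Pcoord (vec3 S U P) = P.
Proof. by rewrite /Pcoord !mxE. Qed.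

Definition vec3E := (Scoord_vec3, Ucoord_vec3, Pcoord_vec3).

Lemma sqrt3_neq0 : r3 != 0. Proof. by rewrite sqrtr_eq0 -ltNge. Qed.

(** With the root out of the denominators, [vector_fieldE] becomes an identity with [r3] as an
    indeterminate. *)
Lemma inv_sqrt3 : r3^-1 = r3 / 3.
Proof.
by rewrite -[X in _ / X](@sqr_sqrtr _ 3)// expr2 invfM mulrA divff ?mul1r// sqrt3_neq0.
Qed.

Lemma vector_fieldE lambda X :
  let f := vector_field lambda X in
  [/\ Scoord f = 2 / 3 * energy X * (Scoord X + r3 / 6)
        + Ucoord X ^+ 2 * (r3 / 3 - Scoord X),
      Ucoord f = Ucoord X *
        (1 - lambda / 2 * Pcoord X + 2 / 3 * energy X - Ucoord X ^+ 2) &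
      Pcoord f = 2 / 3 * energy X * Pcoord X
        + Ucoord X ^+ 2 * (lambda - Pcoord X)].
Proof.
rewrite /vector_field /= !vec3E.
rewrite /energy !invfM !mul1r inv_sqrt3.
by split; field.
Qed.

Lemma lipschitz_vector_field lambda : lipschitz_on_bounded (vector_field lambda).
Proof.
apply: lipschitz_on_bounded_rV => -[[|[|[|//]]] i3];
  rewrite /vector_field /vec3; under eq_fun do rewrite mxE /=;
  rewrite /Scoord /Ucoord /Pcoord; lipschitz_on_bounded_tac.
Qed.

Lemma near_ball_le (p : 'rV[R]_3) (Q : 'rV[R]_3 -> Prop) (e : R) : 0 < e ->
  (\forall X \near p, Q X) ->
  exists2 r, 0 < r <= e & forall X, `|X - p| < r -> Q X.
Proof.
move=> e0 /near_normP[r r0 rQ]; exists (Num.min r e).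
  by rewrite lt_min r0 e0 ge_min lexx orbT.
by move=> X; rewrite lt_min => /andP[/rQ].
Qed.

Lemma is_derive_coords (x : R -> 'rV[R]_3) (t : R) (v : 'rV[R]_3) :
  is_derive t 1 x v ->
  [/\ is_derive t 1 (fun s => Scoord (x s)) (Scoord v),
      is_derive t 1 (fun s => Ucoord (x s)) (Ucoord v) &
      is_derive t 1 (fun s => Pcoord (x s)) (Pcoord v)].
Proof. by move=> /is_derive_rV xv; split; exact: xv. Qed.

Lemma is_derive_energy (x : R -> 'rV[R]_3) (t : R) (v : 'rV[R]_3) :
  is_derive t 1 x v -> is_derive t 1 (fun s => energy (x s))
    (6 * Scoord (x t) * Scoord v + 3 * Pcoord (x t) * Pcoord v).
Proof.
move=> /is_derive_coords[dS _ dP]; rewrite /energy.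
by apply: is_derive_eq; rewrite /GRing.scale/=; field.
Qed.

Lemma is_derive_sqrU (x : R -> 'rV[R]_3) (t : R) (v : 'rV[R]_3) :
  is_derive t 1 x v ->
  is_derive t 1 (fun s => Ucoord (x s) ^+ 2) (2 * Ucoord (x t) * Ucoord v).
Proof.
move=> /is_derive_coords[_ dU _].
by apply: is_derive_eq; rewrite /GRing.scale/=; ring.
Qed.

(* The growth rate of U, and the two coefficients in E' = rateE E + couplingE U^2. *)
Definition rateU lambda X := 1 - lambda / 2 * Pcoord X + 2 / 3 * energy X - Ucoord X ^+ 2.
Definition rateE X := 2 / 3 * (2 * (energy X + 1) + r3 * Scoord X).
Definition couplingE lambda X :=
  2 * r3 * Scoord X - 2 * (energy X + 1) + 3 * lambda * Pcoord X.

Lemma energy_field lambda X : let f := vector_field lambda X in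
  6 * Scoord X * Scoord f + 3 * Pcoord X * Pcoord f =
  rateE X * energy X + couplingE lambda X * Ucoord X ^+ 2.
Proof.
have [/= -> _ ->] := vector_fieldE lambda X.
by rewrite /rateE /couplingE /energy; field.
Qed.

Lemma sqrU_field lambda X :
  2 * Ucoord X * Ucoord (vector_field lambda X) = 2 * rateU lambda X * Ucoord X ^+ 2.
Proof. by have [/= _ -> _] := vector_fieldE lambda X; rewrite /rateU; ring. Qed.

(** The point [q] is the radial projection: [U] is set to 0 and [(S, P)] is scaled by
    [k = (1 + E)^(-1/2)], which lands on the ellipse. The identity [(1 - k) (1 + k) (1 + E) = E]
    bounds [1 - k] by [2 |E|], and [|S|], [|P|] are at most 1. *)
Lemma dist_Sigma X : `|energy X| <= 1 / 2 ->
  exists2 q, Sigma q & `|X - q| <= `|Ucoord X| + 2 * `|energy X|.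
Proof.
set E := energy X => Eh.
have E1 : 0 < 1 + E by move: Eh; rewrite ler_norml; lra.
have s0 : 0 < Num.sqrt (1 + E) by rewrite sqrtr_gt0.
have sE : Num.sqrt (1 + E) ^+ 2 = 1 + E by rewrite sqr_sqrtr// ltW.
pose k := (Num.sqrt (1 + E))^-1.
have k2 : k ^+ 2 * (1 + E) = 1 by rewrite -sE /k exprVn mulVf// expf_neq0// gt_eqF.
have k0 : 0 < k by rewrite invr_gt0.
have EX : 3 * Scoord X ^+ 2 + 3 / 2 * Pcoord X ^+ 2 = 1 + E by rewrite /E /energy; ring.
have kE : `|1 - k| <= 2 * `|E|.
  have : `|1 - k| * (1 + k) * (1 + E) = `|E|.
    rewrite -[1 + k]gtr0_norm ?addr_gt0// -[1 + E]gtr0_norm// -!normrM.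
    congr (`|_|).
    have -> : (1 - k) * (1 + k) * (1 + E) = 1 + E - k ^+ 2 * (1 + E) by ring.
    by rewrite k2 addrAC subrr add0r.
  have := normr_ge0 (1 - k); have := mulr_gt0 k0 E1.
  move: Eh; rewrite ler_norml => Eh; nra.
exists (vec3 (k * Scoord X) 0 (k * Pcoord X)).
  rewrite /Sigma/= !vec3E.
  by split => //; rewrite -[RHS]k2 -EX; ring.
have shrink a : a ^+ 2 <= 1 -> `|a - k * a| <= 2 * `|E|.
  move=> a1; rewrite -{1}[a]mul1r -mulrBl normrM.
  have : `|a| ^+ 2 <= 1 by rewrite real_normK// num_real.
  have := normr_ge0 a; have := normr_ge0 (1 - k); move: kE; nra.
have E0 := normr_ge0 E; have U0 := normr_ge0 (Ucoord X).
move: Eh; rewrite ler_norml => Eh.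
have S2 : Scoord X ^+ 2 <= 1 by have := sqr_ge0 (Pcoord X); nra.
have P2 : Pcoord X ^+ 2 <= 1 by have := sqr_ge0 (Scoord X); nra.
apply: ler_rV_norm => [|[[|[|[|//]]] i3]]; first lra.
- rewrite !mxE /=.
  rewrite (_ : Ordinal i3 = 0); last exact/val_inj.
  by have := shrink _ S2; rewrite /Scoord; lra.
- rewrite !mxE /= subr0.
  rewrite (_ : Ordinal i3 = 1); last exact/val_inj.
  by rewrite /Ucoord in U0 *; lra.
- rewrite !mxE /=.
  rewrite (_ : Ordinal i3 = 2); last exact/val_inj.
  by have := shrink _ P2; rewrite /Pcoord; lra.
Qed.

End System.

(** * Backward decay near the critical set *)

(** Continuous induction: at the infimum of the times with [rho <= q] the step hypothesis gives
    [q < rho], and continuity extends this a little further, a contradiction. At [t = 0] the inner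
    hypothesis is vacuous, so the step also covers the start. *)
Lemma continuous_trap (R : realType) (q : R -> R) (T rho : R) :
  (forall s, 0 <= s <= T -> {for s, continuous q}) ->
  (forall t, 0 <= t <= T -> (forall s, 0 <= s < t -> q s < rho) -> q t < rho) ->
  forall t, 0 <= t <= T -> q t < rho.
Proof.
move=> cq step t /andP[t0 tT]; rewrite ltNge; apply/negP => rqt.
pose B := [set s | 0 <= s <= T /\ rho <= q s].
have Bt : B t by rewrite /B/= t0 tT.
have lbB : lbound B 0 by move=> s [/andP[]].
have infB s : B s -> inf B <= s by move=> Bs; apply: ge_inf => //; exists 0.
have m0 : 0 <= inf B by apply: lb_le_inf => //; exists t.
have mT : 0 <= inf B <= T by rewrite m0 (le_trans (infB _ Bt)).
have /step : 0 <= inf B <= T by [].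
have below s : 0 <= s < inf B -> q s < rho.
  move=> /andP[s0 sm]; rewrite ltNge; apply/negP => rqs.
  have : B s by split => //; rewrite s0 (le_trans (ltW sm))//; case/andP: mT.
  by move=> /infB; rewrite leNgt sm.
move=> /(_ below); rewrite -subr_gt0 => qm.
have /continuous_normP/(_ _ qm)[r r0 qr] := cq _ mT.
suff : inf B + r <= inf B by lra.
apply: lb_le_inf; first by exists t.
move=> s Bs; rewrite leNgt; apply/negP => smr.
have := qr s; rewrite ger0_norm ?subr_ge0 ?infB// => /(_ ltac:(lra)).
by case: Bs => _; rewrite ltr_norml; lra.
Qed.

Section Decay.
Context (R : realType) (lambda : R) (p : 'rV[R]_3) (c B C K r rho : R).
Hypotheses (c0 : 0 < c) (C0 : 0 < C) (r0 : 0 < r) (rho0 : 0 < rho).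
(** [Kc] says [K = 1 + (B / c)^2], large enough to absorb the coupling term. [r_rho] turns
    [U^2 <= r] into [|U| <= rho / 2], and [Cr_rho] bounds the total displacement of [S] and [P]. *)
Hypothesis Kc : K * c ^+ 2 = B ^+ 2 + c ^+ 2.
Hypothesis r_rho : r <= rho ^+ 2 / 4.
Hypothesis Cr_rho : 4 * C * r / c <= rho / 4.
Hypothesis Up : Ucoord p = 0.
Hypothesis ball_p : forall X, `|X - p| < rho ->
  [/\ c <= rateU lambda X, c <= rateE X, `|couplingE lambda X| <= B,
      `|2 / 3 * (Scoord X + Num.sqrt 3 / 6)| <= C /\
      `|Num.sqrt 3 / 3 - Scoord X| <= C &
      `|2 / 3 * Pcoord X| <= C /\ `|lambda - Pcoord X| <= C].

Definition lyapunov (X : 'rV[R]_3) := energy X ^+ 2 + K * (Ucoord X ^+ 2) ^+ 2.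

Let K1 : 1 <= K.
Proof.
rewrite -(@ler_pM2r _ (c ^+ 2)) ?exprn_gt0// mul1r Kc lerDr; exact: sqr_ge0.
Qed.

(** Here [u] stands for [U^2], and the signs are those of reversed time. Once the rates are replaced
    by [c], the remaining quadratic form times [c] is [(c E + b u)^2 + (3 K c^2 - b^2) u^2],
    nonnegative by [Kc]. *)
Let lyapunov_decay (E u al be b : R) : c <= al -> c <= be -> `|b| <= B ->
  2 * E * - (be * E + b * u) + 2 * K * u * - (2 * al * u)
    <= - c * (E ^+ 2 + K * u ^+ 2).
Proof.
move=> cal cbe bB.
have b2 : b ^+ 2 <= B ^+ 2.
  by rewrite -(real_normK (num_real b)) ler_sqr// nnegrE (le_trans _ bB).
have hE : 0 <= (be - c) * E ^+ 2 by rewrite mulr_ge0 ?subr_ge0 ?sqr_ge0.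
have hu : 0 <= K * ((al - c) * u ^+ 2).
  by apply: mulr_ge0; [exact: le_trans K1|rewrite mulr_ge0 ?subr_ge0 ?sqr_ge0].
suff : 0 <= c * E ^+ 2 + 2 * b * E * u + 3 * c * K * u ^+ 2 by nra.
rewrite -(pmulr_rge0 _ c0).
have -> : c * (c * E ^+ 2 + 2 * b * E * u + 3 * c * K * u ^+ 2) =
    (c * E + b * u) ^+ 2 + (3 * (K * c ^+ 2) - b ^+ 2) * u ^+ 2 by ring.
rewrite Kc addr_ge0 ?sqr_ge0// mulr_ge0 ?sqr_ge0//.
by have := sqr_ge0 B; have := sqr_ge0 c; lra.
Qed.

Variables (x : R -> 'rV[R]_3) (T : R).
Hypothesis xE : forall s, 0 <= s <= T ->
  is_derive s 1 x (time_reversed (vector_field lambda) (x s)).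
(** Open at [T]: this is what the step of [continuous_trap] supplies, and the conclusion at [T] is
    what it asks for. *)
Hypothesis x_ball : forall s, 0 <= s < T -> `|x s - p| < rho.
Hypothesis x_start : `|x 0 - p| <= rho / 4.
Hypothesis x_lyapunov : lyapunov (x 0) <= r ^+ 2.

Let sub s t : 0 <= s <= t -> t <= T -> 0 <= s <= T.
Proof. by move=> /andP[-> st] tT; exact: le_trans tT. Qed.

Lemma decay t : 0 <= t <= T ->
  `|energy (x t)| <= r * expR (- (c / 2) * t) /\
  Ucoord (x t) ^+ 2 <= r * expR (- (c / 2) * t).
Proof.
move=> /andP[t0 tT].
pose dE s := - (rateE (x s) * energy (x s)
                + couplingE lambda (x s) * Ucoord (x s) ^+ 2).
pose du s := - (2 * rateU lambda (x s) * Ucoord (x s) ^+ 2).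
have Wt : lyapunov (x t) <= lyapunov (x 0) * expR (- c * t).
  apply: (@gronwall _ (fun s => lyapunov (x s)) (fun s =>
    2 * energy (x s) * dE s + 2 * K * Ucoord (x s) ^+ 2 * du s)) => // s st.
    have sT := sub st tT.
    have hE : is_derive s 1 (fun s => energy (x s)) (dE s).
      have h := is_derive_energy (xE sT); apply: is_derive_eq.
      by rewrite /dE -energy_field /time_reversed /Scoord /Pcoord !mxE; ring.
    have hu : is_derive s 1 (fun s => Ucoord (x s) ^+ 2) (du s).
      have h := is_derive_sqrU (xE sT); apply: is_derive_eq.
      by rewrite /du -sqrU_field /time_reversed /Ucoord !mxE; ring.
    by rewrite /lyapunov; apply: is_derive_eq; rewrite /GRing.scale/=; ring.
  have /x_ball/ball_p[hU hE hb _ _] : 0 <= s < T.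
    by case/andP: st => /ltW-> /lt_le_trans->.
  exact: lyapunov_decay.
(* Writing the bound as a square halves the rate; since [1 <= K], it then bounds both [|E|] and
   [U^2]. *)
have {Wt} : lyapunov (x t) <= (r * expR (- (c / 2) * t)) ^+ 2.
  apply: le_trans Wt _; rewrite exprMn -expRM_natl mulr_natl.
  rewrite (_ : - (c / 2) * t *+ 2 = - c * t); last by field.
  by rewrite ler_pM2r ?expR_gt0.
set e := r * _; have e0 : 0 < e by rewrite mulr_gt0 ?expR_gt0.
rewrite /lyapunov; set E := energy _; set u := Ucoord _ ^+ 2 => W.
have u0 : 0 <= u by rewrite sqr_ge0.
have KU : u ^+ 2 <= K * u ^+ 2 by rewrite ler_peMl ?sqr_ge0.
have E2 : `|E| ^+ 2 <= e ^+ 2.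
  rewrite real_normK ?num_real//; have := sqr_ge0 u; lra.
have u2 : u ^+ 2 <= e ^+ 2 by have := sqr_ge0 E; lra.
by move: E2 u2; rewrite !ler_sqr ?nnegrE// ltW.
Qed.

Let displacement (q dq a b : R -> R) :
  (forall s, 0 <= s <= T -> is_derive s 1 q (dq s)) ->
  (forall s, dq s = - (energy (x s) * a s + Ucoord (x s) ^+ 2 * b s)) ->
  (forall s, 0 <= s < T -> `|a s| <= C /\ `|b s| <= C) ->
  0 <= T -> `|q T - q 0| <= rho / 4.
Proof.
move=> qE dqE abC T0.
(* A primitive of [2 * C * r * expR (- (c / 2) * s)], the bound on the speed; its increase never
   exceeds [4 * C * r / c], whatever [T] is. *)
pose h s := - (4 * C * r / c) * expR (- (c / 2) * s).
have : `|q T - q 0| <= h T - h 0.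
  apply: (@is_derive_dist_le _ q dq h
    (fun s => 2 * C * r * expR (- (c / 2) * s))) => // s sT.
    have := is_derive_expRM (- (c / 2)) s => ?; rewrite /h; apply: is_derive_eq.
    by rewrite /GRing.scale/=; field; rewrite gt_eqF.
  case/andP: (sT) => /ltW s0 sltT; have sT' : 0 <= s <= T by rewrite s0 ltW.
  have [hE hu] := decay sT'.
  have [|aC bC] := abC s; first by rewrite s0.
  rewrite dqE normrN; apply: le_trans (ler_normD _ _) _.
  rewrite (normrM (energy _)) (normrM (_ ^+ 2)).
  have u0 := sqr_ge0 (Ucoord (x s)); rewrite [`|_ ^+ 2|]ger0_norm//.
  have -> : 2 * C * r * expR (- (c / 2) * s) =
    r * expR (- (c / 2) * s) * C + r * expR (- (c / 2) * s) * C by ring.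
  by apply: lerD; apply: ler_pM.
move=> /le_trans; apply; apply: le_trans Cr_rho.
rewrite /h mulr0 expR0 mulr1 opprK mulNr gerDr oppr_le0.
by rewrite mulr_ge0 ?expR_ge0 ?divr_ge0 ?mulr_ge0 ?ltW.
Qed.

(** For [S] and [P] the start and the displacement contribute [rho / 4] each; for [U], which
    vanishes at [p], the decay of [U^2] suffices. Half the radius is what closes the trap. *)
Lemma decay_ball : 0 <= T -> `|x T - p| <= rho / 2.
Proof.
move=> T0; have TT : 0 <= T <= T by rewrite T0 lexx.
have hS : `|Scoord (x T) - Scoord (x 0)| <= rho / 4.
  apply: (@displacement (fun s => Scoord (x s))
    (fun s => Scoord (time_reversed (vector_field lambda) (x s)))
    (fun s => 2 / 3 * (Scoord (x s) + Num.sqrt 3 / 6))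
    (fun s => Num.sqrt 3 / 3 - Scoord (x s))) => //.
  - by move=> s sT; have [] := is_derive_coords (xE sT).
  - move=> s; rewrite /time_reversed {1}/Scoord mxE -/(Scoord _).
    by have [/= -> _ _] := vector_fieldE lambda (x s); ring.
  - by move=> s sT; have [] := ball_p (x_ball sT).
have hP : `|Pcoord (x T) - Pcoord (x 0)| <= rho / 4.
  apply: (@displacement (fun s => Pcoord (x s))
    (fun s => Pcoord (time_reversed (vector_field lambda) (x s)))
    (fun s => 2 / 3 * Pcoord (x s)) (fun s => lambda - Pcoord (x s))) => //.
  - by move=> s sT; have [] := is_derive_coords (xE sT).
  - move=> s; rewrite /time_reversed {1}/Pcoord mxE -/(Pcoord _).
    by have [/= _ _ ->] := vector_fieldE lambda (x s); ring.
  - by move=> s sT; have [] := ball_p (x_ball sT).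
have hU : `|Ucoord (x T)| <= rho / 2.
  rewrite -ler_sqr ?nnegrE//; last by rewrite divr_ge0 ?ltW.
  rewrite real_normK ?num_real//; have [_ /le_trans] := decay TT; apply.
  apply: (@le_trans _ _ r).
    apply: ler_piMr; first exact: ltW.
    by rewrite -[leRHS]expR0 ler_expR mulNr oppr_le0 mulr_ge0 ?divr_ge0 ?(ltW c0).
  by apply: le_trans r_rho _; rewrite expr_div_n -natrX.
have start i : `|x 0 0 i - p 0 i| <= rho / 4.
  by apply: le_trans x_start; apply: le_trans (ler_coord_norm _ i); rewrite !mxE.
have coord i : `|x T 0 i - x 0 0 i| <= rho / 4 -> `|x T 0 i - p 0 i| <= rho / 2.
  have := start i; have := ler_distD (x 0 0 i) (x T 0 i) (p 0 i); lra.
apply: ler_rV_norm => [|[[|[|[|//]]] i3]]; first by rewrite divr_ge0 ?ltW.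
- rewrite !mxE (_ : Ordinal i3 = 0); last exact/val_inj.
  exact: coord hS.
- rewrite !mxE (_ : Ordinal i3 = 1); last exact/val_inj.
  by move: Up hU; rewrite /Ucoord => ->; rewrite subr0.
- rewrite !mxE (_ : Ordinal i3 = 2); last exact/val_inj.
  exact: coord hP.
Qed.

End Decay.

(** * Past stability and convergence to the critical set *)

Section Stability.
Context (R : realType) (lambda S0 P0 : R).
Local Notation f := (vector_field lambda).
Local Notation p := (vec3 S0 0 P0).
Local Notation r3 := (Num.sqrt 3 : R).
Hypothesis Sp : Sigma p.

Let ellipse : 3 * S0 ^+ 2 + 3 / 2 * P0 ^+ 2 = 1.
Proof. by case: Sp; rewrite !vec3E. Qed.

Let energy_p : energy p = 0.
Proof. by rewrite /energy !vec3E ellipse subrr. Qed.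

Lemma rateU_p : rateU lambda p = 1 - lambda / 2 * P0.
Proof. by rewrite /rateU energy_p !vec3E; ring. Qed.

Lemma rateE_p : rateE p = 2 / 3 * (2 + r3 * S0).
Proof. by rewrite /rateE energy_p !vec3E; ring. Qed.

(** On the ellipse [(r3 * S0)^2 = 3 S0^2 <= 1], so [2 + r3 * S0] is at least 1. *)
Lemma rateE_p_ge : 2 / 3 <= rateE p.
Proof.
rewrite rateE_p; have : (r3 * S0) ^+ 2 <= 1.
  by rewrite exprMn sqr_sqrtr//; have := ellipse; have := sqr_ge0 P0; lra.
by nra.
Qed.

Lemma lipschitz_rateU : lipschitz_on_bounded (rateU lambda).
Proof.
by rewrite /rateU /energy /Scoord /Ucoord /Pcoord; lipschitz_on_bounded_tac.
Qed.

Lemma lipschitz_rateE : lipschitz_on_bounded (@rateE R).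
Proof. by rewrite /rateE /energy /Scoord /Pcoord; lipschitz_on_bounded_tac. Qed.

Lemma lipschitz_couplingE : lipschitz_on_bounded (couplingE lambda).
Proof.
by rewrite /couplingE /energy /Scoord /Pcoord; lipschitz_on_bounded_tac.
Qed.

Let near_bound (h : 'rV[R]_3 -> R) C : lipschitz_on_bounded h -> `|h p| + 1 <= C ->
  \forall X \near p, `|h X| <= C.
Proof.
move=> hL hC; apply: filterS (lipschitz_on_bounded_near p hL ltr01) => X hX.
by have := ler_normD (h X - h p) (h p); rewrite subrK; lra.
Qed.

(** Serves both halves of (b): the [eps] bound with global existence is past stability, and the
    exponential bounds give convergence to [Sigma]. *)
Lemma past_attraction (eps : R) : lambda * P0 < 2 -> 0 < eps ->
  exists2 k, 0 < k & exists2 delta, 0 < delta & forall J x,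
    maximal_solution (time_reversed f) J x -> `|x 0 - p| < delta ->
    forall t, 0 <= t -> [/\ J t, `|x t - p| < eps,
      `|energy (x t)| <= 1 / 2 * expR (- k * t) &
      Ucoord (x t) ^+ 2 <= expR (- k * t)].
Proof.
move=> lP eps0.
(* Both rates are at least [2 * c] at [p], hence at least [c] wherever they differ from their values
   at [p] by less than [c]. *)
pose c := Num.min ((1 - lambda / 2 * P0) / 2) (1 / 3).
have c0 : 0 < c by rewrite lt_min; apply/andP; split; lra.
have cU : c <= rateU lambda p - c.
  have : c <= (1 - lambda / 2 * P0) / 2 by rewrite ge_min lexx.
  by rewrite rateU_p; lra.
have cE : c <= rateE p - c.
  have : c <= 1 / 3 by rewrite ge_min lexx orbT.
  by have := rateE_p_ge; lra.
pose a1 X := 2 / 3 * (Scoord X + r3 / 6); pose a2 X := r3 / 3 - Scoord X.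
pose b1 (X : 'rV[R]_3) := 2 / 3 * Pcoord X; pose b2 X := lambda - Pcoord X.
pose C := `|a1 p| + `|a2 p| + `|b1 p| + `|b2 p| + 1.
have [A1 [A2 [B1 B2]]] := (normr_ge0 (a1 p), (normr_ge0 (a2 p),
  (normr_ge0 (b1 p), normr_ge0 (b2 p)))).
have C0 : 0 < C by rewrite /C; lra.
pose B := `|couplingE lambda p| + 1.
have nU := lipschitz_on_bounded_near p lipschitz_rateU c0.
have nE := lipschitz_on_bounded_near p lipschitz_rateE c0.
have nB : \forall X \near p, `|couplingE lambda X| <= B.
  by apply: near_bound; [exact: lipschitz_couplingE|].
have na1 : \forall X \near p, `|a1 X| <= C.
  by apply: near_bound; [rewrite /a1 /Scoord; lipschitz_on_bounded_tac|rewrite /C; lra].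
have na2 : \forall X \near p, `|a2 X| <= C.
  by apply: near_bound; [rewrite /a2 /Scoord; lipschitz_on_bounded_tac|rewrite /C; lra].
have nb1 : \forall X \near p, `|b1 X| <= C.
  by apply: near_bound; [rewrite /b1 /Pcoord; lipschitz_on_bounded_tac|rewrite /C; lra].
have nb2 : \forall X \near p, `|b2 X| <= C.
  by apply: near_bound; [rewrite /b2 /Pcoord; lipschitz_on_bounded_tac|rewrite /C; lra].
have [rho /andP[rho0 rho_eps] ball_p] := near_ball_le eps0
  (filterI nU (filterI nE (filterI nB (filterI (filterI na1 na2) (filterI nb1 nb2))))).
have {}ball_p X : `|X - p| < rho ->
    [/\ c <= rateU lambda X, c <= rateE X, `|couplingE lambda X| <= B,
      `|a1 X| <= C /\ `|a2 X| <= C & `|b1 X| <= C /\ `|b2 X| <= C].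
  move=> /ball_p[hU [hE [hB [ha hb]]]]; split=> //.
    by move: hU; rewrite ltr_norml; lra.
  by move: hE; rewrite ltr_norml; lra.
(* The three bounds give, in order, [r_rho], the prefactors in the conclusion, and [Cr_rho]. *)
pose r := Num.min (rho ^+ 2 / 4) (Num.min (1 / 2) (rho * c / (16 * C))).
have r0 : 0 < r.
  by rewrite !lt_min !divr_gt0 ?exprn_gt0 ?mulr_gt0.
have r_rho : r <= rho ^+ 2 / 4 by rewrite ge_min lexx.
have r_half : r <= 1 / 2 by rewrite !ge_min lexx orbT.
have Cr_rho : 4 * C * r / c <= rho / 4.
  have : r <= rho * c / (16 * C) by rewrite !ge_min lexx !orbT.
  rewrite ler_pdivlMr ?mulr_gt0// ler_pdivrMr//; lra.
pose K := B ^+ 2 / c ^+ 2 + 1.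
have Kc : K * c ^+ 2 = B ^+ 2 + c ^+ 2.
  by rewrite /K; field; rewrite gt_eqF.
have lyapunov_p : lyapunov K p = 0.
  by rewrite /lyapunov energy_p !vec3E; ring.
have nW : \forall X \near p, `|lyapunov K X - lyapunov K p| < r ^+ 2.
  apply: lipschitz_on_bounded_near; last exact: exprn_gt0.
  rewrite /lyapunov /energy /Scoord /Ucoord /Pcoord; lipschitz_on_bounded_tac.
have rho4 : 0 < rho / 4 by rewrite divr_gt0.
have [delta /andP[delta0 delta_rho] Wdelta] := near_ball_le rho4 nW.
exists (c / 2); first by rewrite divr_gt0.
exists delta => // J x xJ x0.
have x_lyapunov : lyapunov K (x 0) <= r ^+ 2.
  by have := Wdelta _ x0; rewrite lyapunov_p subr0 ltr_norml; lra.
have x_start : `|x 0 - p| <= rho / 4 by lra.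
have [[_ iJ J0 xE] _] := xJ.
have xE' T : J T -> forall s, 0 <= s <= T ->
    is_derive s 1 x (time_reversed f (x s)).
  by move=> JT s sT; apply: xE; exact: (iJ _ _ J0 JT).
have Up : Ucoord p = 0 by rewrite vec3E.
(* Trapping comes first, on the interval of existence; the resulting boundedness then gives global
   existence. *)
have in_ball T : J T -> 0 <= T -> `|x T - p| < rho.
  move=> JT T0; apply: (@continuous_trap _ (fun s => `|x s - p|) T) => //.
  - move=> s sT; apply: continuous_comp; last exact: norm_continuous.
    apply: continuousB; last exact: cst_continuous.
    exact: is_derive_continuous (xE' _ JT _ sT).
  - move=> t /andP[t0 tT] x_ball.
    have Jt : J t by apply: (iJ _ _ J0 JT); rewrite t0.
    have := decay_ball c0 C0 r0 rho0 Kc r_rho Cr_rho Up ball_p (xE' _ Jt) x_ball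
      x_start x_lyapunov t0.
    lra.
  - by rewrite T0 lexx.
have Jall : forall t, 0 <= t -> J t.
  apply: (bounded_maximal_solution (M := rho + `|p|)) xJ _.
    exact/lipschitz_on_bounded_reversed/lipschitz_vector_field.
  move=> t Jt t0; have := in_ball t Jt t0.
  by have := ler_normD (x t - p) p; rewrite subrK; lra.
move=> t t0; have Jt := Jall t t0.
have x_ball s : 0 <= s < t -> `|x s - p| < rho.
  by move=> /andP[s0 _]; apply: in_ball => //; exact: Jall.
have tt : 0 <= t <= t by rewrite t0 lexx.
have [hE hU] := decay c0 r0 Kc ball_p (xE' _ Jt) x_ball x_lyapunov tt.
split => //.
- by apply: lt_le_trans rho_eps; exact: in_ball.
- by apply: le_trans hE _; rewrite ler_pM2r ?expR_gt0.
- apply: le_trans hU _; rewrite ler_piMl ?expR_ge0//; lra.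
Qed.

Lemma past_stable_Sigma : lambda * P0 < 2 -> past_stable f p.
Proof.
move=> lP eps eps0; have [k _ [delta d0 H]] := past_attraction lP eps0.
by exists delta => // J x xJ x0 t t0; have [] := H J x xJ x0 t t0.
Qed.

(** [dist_Sigma] yields a point within [2 * e]; the third [e] leaves room for the strict inequality
    defining a ball. *)
Lemma edist_inf_Sigma_le (X : 'rV[R]_3) (e : R) : `|energy X| <= 1 / 2 * e ->
  0 < e <= 1 -> `|Ucoord X| <= e -> (edist_inf (@Sigma R) X <= (3 * e)%:E)%E.
Proof.
move=> EX /andP[e0 e1] UX; have [|q Sq qX] := @dist_Sigma _ X; first by lra.
apply: ge_ereal_inf; exists (edist (X, q)); first by exists q.
apply: ge_ereal_inf; exists (3 * e)%:E; last by [].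
exists (3 * e) => //; split; first lra.
by rewrite -ball_normE/=; lra.
Qed.

Lemma past_converges_Sigma : lambda * P0 < 2 ->
  \forall X \near p, past_converges f (@Sigma R) X.
Proof.
move=> lP; have [k k0 [delta d0 H]] := past_attraction lP ltr01.
apply/near_normP; exists delta => // X Xp J x xJ x0.
have {}H t : t <= 0 -> [/\ J t, `|energy (x t)| <= 1 / 2 * expR (k * t) &
    Ucoord (x t) ^+ 2 <= expR (k * t)].
  move=> t0; have := H _ _ (maximal_solution_reversed xJ).
  rewrite /= oppr0 x0 => /(_ Xp (- t)); rewrite oppr_ge0 => /(_ t0).
  by rewrite opprK mulrNN => -[].
split=> [t /H[]//|].
(* The rate is halved because the bound is on [U^2] while the distance involves [|U|]. *)
pose h t := (3 * expR (k / 2 * t))%:E.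
apply: (@squeeze_cvge _ _ _ _ (cst 0%E) _ h); last 2 first.
- exact: cvg_cst.
- apply/fine_cvgP; split; first exact: nearW.
  apply/cvgrPdist_lt => e e0; near=> t.
  rewrite sub0r normrN ger0_norm ?mulr_ge0 ?expR_ge0//.
  (* With [y = - (k / 2 * t)] this says [3 / e <= y], and [1 + y <= expR y] then gives
     [3 * expR (- y) < e]. *)
  have : t <= - (2 / k * (3 / e)) by near: t; apply: nbhs_ninfty_le; exact: num_real.
  move=> te; have y0 : 3 / e <= - (k / 2 * t).
    rewrite -mulrN -ler_pdivrMl ?divr_gt0// invf_div; lra.
  rewrite -ltr_pdivlMl// -[k / 2 * t]opprK expRN -[ltRHS]invrK ltf_pV2 ?posrE
    ?expR_gt0 ?invr_gt0 ?mulr_gt0 ?invr_gt0//.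
  rewrite invfM invrK; apply: lt_le_trans (expR_ge1Dx _); lra.
near=> t; have t0 : t <= 0 by near: t; apply: nbhs_ninfty_le; exact: num_real.
have [_ hE hU] := H t t0; rewrite edist_inf_ge0/=; apply: edist_inf_Sigma_le.
- apply: le_trans hE _; rewrite ler_pM2l// ler_expR; nra.
- by rewrite expR_gt0 -[leRHS]expR0 ler_expR; nra.
- rewrite -ler_sqr ?nnegrE ?expR_ge0// real_normK ?num_real//.
  apply: le_trans hU _; rewrite -expRM_natl ler_expR; lra.
Unshelve. all: by end_near. Qed.

End Stability.

(** * Instability *)

(** A Chetaev-type criterion: stability would keep a solution in the ball forever, where [q] is
    bounded by [B] yet grows exponentially. The set [A] allows initial data on an invariant
    subset. *)
Lemma growth_not_future_stable (R : realType) n (f : 'rV[R]_n -> 'rV[R]_n)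
    (p : 'rV[R]_n) (A : set 'rV[R]_n) (q : 'rV[R]_n -> R) (rho c B : R) :
  lipschitz_on_bounded f -> 0 < rho -> 0 < c ->
  (forall X, `|X - p| < rho -> q X <= B) ->
  (forall delta, 0 < delta -> exists X, [/\ `|X - p| < delta, A X & 0 < q X]) ->
  (forall x : R -> 'rV[R]_n, (forall t : R, 0 <= t -> is_derive t 1 x (f (x t))) ->
    (forall t, 0 <= t -> `|x t - p| < rho) -> A (x 0) ->
    exists dq : R -> R, forall t : R, 0 <= t ->
      is_derive t 1 (fun s => q (x s)) (dq t) /\ c * q (x t) <= dq t) ->
  ~ future_stable f p.
Proof.
move=> fL rho0 c0 qB near growth /(_ rho rho0)[delta delta0 stable].
have [X [Xp AX qX]] := near delta delta0.
have [J [x [xJ x0]]] := exists_maximal_solution X fL.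
have Jx t : 0 <= t -> J t /\ `|x t - p| < rho.
  by move=> t0; apply: stable xJ _ t t0; rewrite x0.
have xE (t : R) : 0 <= t -> is_derive t 1 x (f (x t)).
  by move=> /Jx[Jt _]; case: xJ => -[_ _ _ xE] _; exact: xE.
have [||dq dqP] := growth x xE; [by move=> t /Jx[]|by rewrite x0|].
have B0 : 0 < B.
  by apply: lt_le_trans qX _; apply: qB; rewrite -x0; case: (Jx 0 (lexx _)).
(* By [1 + c * T <= expR (c * T)] the value of [q] at this time is at least [q X + B], above the
   bound [B]. *)
pose T := B / (q X * c).
have T0 : 0 <= T by rewrite divr_ge0 ?mulr_ge0 ?ltW.
have : q (x 0) * expR (c * T) <= q (x T).
  apply: (@gronwall_ge _ (fun s => q (x s)) dq) => // s.
    by move=> /andP[/dqP[]].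
  by move=> /andP[/ltW/dqP[]].
have xT : q (x T) <= B by apply: qB; case: (Jx T T0).
have : q X * (1 + c * T) <= q X * expR (c * T).
  by rewrite ler_pM2l// expR_ge1Dx.
rewrite mulrDr mulr1 (_ : q X * (c * T) = B); last first.
  by rewrite /T; field; rewrite !gt_eqF.
rewrite x0; lra.
Qed.

Section Instability.
Context (R : realType) (lambda S0 P0 : R).
Local Notation f := (vector_field lambda).
Local Notation p := (vec3 S0 0 P0).
Hypothesis Sp : Sigma p.

Let energy_p : energy p = 0.
Proof. by case: Sp; rewrite /energy => _ ->; rewrite subrr. Qed.

Lemma not_future_stable_Sigma : ~ future_stable f p.
Proof.
have E2L : lipschitz_on_bounded (fun X : 'rV[R]_3 => energy X ^+ 2).
  by rewrite /energy /Scoord /Pcoord; lipschitz_on_bounded_tac.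
have third : 0 < 1 / 3 :> R by rewrite divr_gt0.
have nE := lipschitz_on_bounded_near p (@lipschitz_rateE R) third.
have nU := lipschitz_on_bounded_near p (lipschitz_rateU lambda) ltr01.
have nq := lipschitz_on_bounded_near p E2L ltr01.
have [rho /andP[rho0 _] ball_p] :=
  near_ball_le ltr01 (filterI nE (filterI nU nq)).
have ellipse : 3 * S0 ^+ 2 + 3 / 2 * P0 ^+ 2 = 1.
  by case: Sp; rewrite !vec3E.
have S1 : `|S0| <= 1.
  have : `|S0| ^+ 2 <= 1.
    by rewrite real_normK ?num_real//; have := sqr_ge0 P0; lra.
  by have := normr_ge0 S0; nra.
have P1 : `|P0| <= 1.
  have : `|P0| ^+ 2 <= 1.
    by rewrite real_normK ?num_real//; have := sqr_ge0 S0; lra.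
  by have := normr_ge0 P0; nra.
(* On the ball [rateE] is at least 1/3, since it is at least 2/3 at [p]; the squared energy grows at
   twice that rate. *)
apply: (@growth_not_future_stable _ _ _ p [set X | Ucoord X = 0]
  (fun X => energy X ^+ 2) rho (2 / 3) 1) => //.
- exact: lipschitz_vector_field.
- move=> X /ball_p[_ [_]]; rewrite energy_p expr0n/= subr0 => /ltW.
  exact/le_trans/ler_norm.
(* Dilating [p] inside the plane [U = 0] gives energy [(1 + d / 2)^2 - 1 > 0]. *)
- move=> d d0; exists (vec3 ((1 + d / 2) * S0) 0 ((1 + d / 2) * P0)); split.
  + have d2 : 0 < d / 2 by rewrite divr_gt0.
    apply: (@le_lt_trans _ _ (d / 2)); last lra.
    have scale a : `|a| <= 1 -> `|(1 + d / 2) * a - a| <= d / 2.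
      move=> a1; have -> : (1 + d / 2) * a - a = d / 2 * a by ring.
      by rewrite normrM (gtr0_norm d2) ler_piMr// ltW.
    apply: ler_rV_norm => [|[[|[|[|//]]] i3]]; first exact: ltW.
    * by rewrite !mxE /=; exact: scale.
    * by rewrite !mxE /= subr0 normr0 ltW.
    * by rewrite !mxE /=; exact: scale.
  + by rewrite /= vec3E.
  + rewrite /energy !vec3E exprn_gt0//.
    have -> : 3 * ((1 + d / 2) * S0) ^+ 2 + 3 / 2 * ((1 + d / 2) * P0) ^+ 2 - 1 =
      (1 + d / 2) ^+ 2 * (3 * S0 ^+ 2 + 3 / 2 * P0 ^+ 2) - 1 by ring.
    by rewrite ellipse mulr1 subr_gt0; nra.
- move=> x xE x_ball /= Ux0.
  pose H := `|rateU lambda p| + 1.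
  (* Invariance of the plane [U = 0], by Gronwall for [U^2] with [H] an upper bound of [rateU] on
     the ball. *)
  have U0 t : 0 <= t -> Ucoord (x t) ^+ 2 = 0.
    move=> t0; apply/eqP; rewrite eq_le sqr_ge0 andbT.
    have -> : 0 = Ucoord (x 0) ^+ 2 * expR (2 * H * t).
      by rewrite Ux0 expr0n/= mul0r.
    apply: (@gronwall _ (fun s => Ucoord (x s) ^+ 2)
      (fun s => 2 * Ucoord (x s) * Ucoord (f (x s)))) => // s.
      by move=> /andP[s0 _]; apply: is_derive_sqrU; exact: xE.
    move=> /andP[/ltW s0 _]; rewrite sqrU_field.
    have [_ [hU _]] := ball_p _ (x_ball s s0).
    have hH : rateU lambda (x s) <= H.
      have h1 : rateU lambda (x s) <= rateU lambda p + 1.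
        by move: hU; rewrite ltr_norml; lra.
      by apply: le_trans h1 _; rewrite lerD2r ler_norm.
    by rewrite -!mulrA ler_pM2l// ler_wpM2r// sqr_ge0.
  exists (fun t => 2 * energy (x t) * (6 * Scoord (x t) * Scoord (f (x t))
    + 3 * Pcoord (x t) * Pcoord (f (x t)))) => t t0; split.
    have := is_derive_energy (xE t t0) => ?; apply: is_derive_eq.
    by rewrite /GRing.scale/=; ring.
  rewrite energy_field (U0 _ t0) mulr0 addr0.
  have [hE _] := ball_p _ (x_ball t t0).
  have : 0 <= (rateE (x t) - 1 / 3) * energy (x t) ^+ 2.
    rewrite mulr_ge0 ?sqr_ge0// subr_ge0.
    by move: hE; have := rateE_p_ge Sp; rewrite ltr_norml; lra.
  lra.
Qed.

Lemma not_past_stable_Sigma : 2 < lambda * P0 -> ~ past_stable f p.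
Proof.
(* At [p] the reversed growth rate of [U] is [2 * c], so it stays above [c] nearby and [U^2] grows
   at rate [2 * c]. *)
move=> lP; pose c := (lambda / 2 * P0 - 1) / 2.
have c0 : 0 < c by rewrite /c; lra.
have nU := lipschitz_on_bounded_near p (lipschitz_rateU lambda) c0.
have [rho /andP[rho0 rho1] ball_p] := near_ball_le ltr01 nU.
apply: (@growth_not_future_stable _ _ _ p setT (fun X => Ucoord X ^+ 2) rho
  (2 * c) 1) => //.
- exact/lipschitz_on_bounded_reversed/lipschitz_vector_field.
- by rewrite mulr_gt0.
- move=> X Xp; have : `|Ucoord X| <= 1.
    apply/ltW; apply: le_lt_trans (lt_le_trans Xp rho1).
    by apply: le_trans (ler_coord_norm _ 1); rewrite !mxE/= subr0.
  rewrite -(real_normK (num_real (Ucoord X))).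
  by have := normr_ge0 (Ucoord X); nra.
- move=> d d0; have d2 : 0 < d / 2 by rewrite divr_gt0.
  exists (vec3 S0 (d / 2) P0); split=> //.
    apply: (@le_lt_trans _ _ (d / 2)); last lra.
    apply: ler_rV_norm => [|[[|[|[|//]]] i3]]; first exact: ltW.
    + by rewrite !mxE /= subrr normr0 ltW.
    + by rewrite !mxE /= subr0 gtr0_norm.
    + by rewrite !mxE /= subrr normr0 ltW.
  by rewrite vec3E exprn_gt0 ?divr_gt0.
- move=> x xE x_ball _.
  exists (fun t => 2 * Ucoord (x t) * Ucoord (time_reversed f (x t))) => t t0.
  split; first by have := is_derive_sqrU (xE t t0).
  rewrite /time_reversed [in Ucoord (- _)]/Ucoord mxE -/(Ucoord _) mulrN sqrU_field.
  have := ball_p _ (x_ball t t0); rewrite (rateU_p lambda Sp) ltr_norml => /andP[_ hU].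
  have : 0 <= (- c - rateU lambda (x t)) * Ucoord (x t) ^+ 2.
    by rewrite mulr_ge0 ?sqr_ge0//; move: hU; rewrite /c; lra.
  lra.
Qed.

End Instability.

(** * Linearization *)

Lemma det_mx33 (R : comNzRingType) (a : nat -> nat -> R) :
  \det (\matrix_(i < 3, j < 3) a i j) =
    a 0 0 * (a 1 1 * a 2 2 - a 1 2 * a 2 1)
    - a 0 1 * (a 1 0 * a 2 2 - a 1 2 * a 2 0)
    + a 0 2 * (a 1 0 * a 2 1 - a 1 1 * a 2 0).
Proof.
rewrite (expand_det_row _ 0) !big_ord_recl big_ord0 /cofactor.
rewrite !(expand_det_row _ 0) !big_ord_recl !big_ord0 /cofactor !det_mx11 !mxE /=.
by rewrite /bump /=; ring.
Qed.

Lemma differentiable_rV (R : realType) (V : normedModType R) n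
    (f : V -> 'rV[R]_n) (p : V) :
  (forall i, differentiable (fun X => f X 0 i) p) -> differentiable f p.
Proof.
move=> fd; have -> : f = \sum_(i < n) (fun X => f X 0 i *: delta_mx 0 i).
  by apply/funext => X; rewrite fct_sumE -row_sum_delta.
by apply: differentiable_sum => i; exact: differentiableZl.
Qed.

Section Linearization.
Context (R : realType) (lambda S0 P0 : R).
Local Notation f := (vector_field lambda).
Local Notation p := (vec3 S0 0 P0).
Local Notation r3 := (Num.sqrt 3 : R).
Hypothesis Sp : Sigma p.

Let ellipse : 3 * S0 ^+ 2 + 3 / 2 * P0 ^+ 2 = 1.
Proof. by case: Sp; rewrite !vec3E. Qed.

Let energy_p : energy p = 0.
Proof. by rewrite /energy !vec3E ellipse subrr. Qed.

Lemma vector_field_Sigma : f p = 0.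
Proof.
have := vector_fieldE lambda p; rewrite energy_p !vec3E => -[hS hU hP].
apply/rowP => -[[|[|[|//]]] i3]; rewrite [RHS]mxE.
- rewrite (_ : Ordinal i3 = 0); last exact/val_inj.
  by move: hS; rewrite /Scoord => ->; ring.
- rewrite (_ : Ordinal i3 = 1); last exact/val_inj.
  by move: hU; rewrite /Ucoord => ->; ring.
- rewrite (_ : Ordinal i3 = 2); last exact/val_inj.
  by move: hP; rewrite /Pcoord => ->; ring.
Qed.

Lemma differentiable_vector_field (X : 'rV[R]_3) : differentiable f X.
Proof.
have D (g h : 'rV[R]_3 -> R) : differentiable g X -> differentiable h X ->
    differentiable (fun Y => g Y + h Y) X by exact: differentiableD.
have N (g : 'rV[R]_3 -> R) : differentiable g X ->
    differentiable (fun Y => - g Y) X by exact: differentiableN.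
have M (g h : 'rV[R]_3 -> R) : differentiable g X -> differentiable h X ->
    differentiable (fun Y => g Y * h Y) X by exact: differentiableM.
have cst (c : R) : differentiable (fun _ : 'rV[R]_3 => c) X.
  exact: differentiable_cst.
have E (g : 'rV[R]_3 -> R) n : differentiable g X ->
    differentiable (fun Y => g Y ^+ n) X.
  move=> gd; elim: n => [|n IH]; first exact: cst.
  by under eq_fun do rewrite exprS; exact: M.
have coord i : differentiable (fun Y : 'rV[R]_3 => Y 0 i) X.
  exact: differentiable_coord.
apply: differentiable_rV => -[[|[|[|//]]] i3];
  rewrite /vector_field /vec3; under eq_fun do rewrite mxE /=;
  rewrite /Scoord /Ucoord /Pcoord;
  repeat first [exact: cst | exact: coord | refine (D _ _ _ _) | refine (N _ _)
               | refine (E _ _ _) | refine (M _ _ _ _)].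
Qed.

(** In the form of [vector_fieldE] every term has a factor [E] or [U], which vanishes at [p]; the
    product rule leaves only the terms that differentiate that factor, and those with [U^2]
    disappear. *)
Lemma is_derive_vector_field (v : 'rV[R]_3) :
  let dE := 6 * S0 * Scoord v + 3 * P0 * Pcoord v in
  is_derive p v f (vec3 (2 / 3 * dE * (S0 + r3 / 6))
    ((1 - lambda / 2 * P0) * Ucoord v) (2 / 3 * dE * P0)).
Proof.
move=> dE.
have [dS dU dP] : [/\ is_derive p v (@Scoord R) (Scoord v),
    is_derive p v (@Ucoord R) (Ucoord v) & is_derive p v (@Pcoord R) (Pcoord v)].
  have /is_derive_rV h := is_derive_id p v.
  by split; [exact: h 0|exact: h 1|exact: h 2].
have hE : is_derive p v (@energy R) dE.
  rewrite /energy; apply: is_derive_eq.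
  by rewrite /GRing.scale/= !vec3E /dE; field.
apply/is_derive_rV => -[[|[|[|//]]] i3].
- rewrite (_ : Ordinal i3 = 0); last exact/val_inj.
  rewrite -[vec3 _ _ _ 0 0]/(Scoord _) vec3E.
  have -> : (fun X => f X 0 0) = (fun X => 2 / 3 * energy X * (Scoord X + r3 / 6)
        + Ucoord X ^+ 2 * (r3 / 3 - Scoord X)).
    by apply/funext => X; have [<-] := vector_fieldE lambda X.
  apply: is_derive_eq.
  by rewrite /GRing.scale/= !vec3E energy_p; ring.
- rewrite (_ : Ordinal i3 = 1); last exact/val_inj.
  rewrite -[vec3 _ _ _ 0 1]/(Ucoord _) vec3E.
  have -> : (fun X => f X 0 1) = (fun X => Ucoord X *
        (1 - lambda / 2 * Pcoord X + 2 / 3 * energy X - Ucoord X ^+ 2)).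
    by apply/funext => X; have [_ <-] := vector_fieldE lambda X.
  apply: is_derive_eq.
  by rewrite /GRing.scale/= !vec3E energy_p; ring.
- rewrite (_ : Ordinal i3 = 2); last exact/val_inj.
  rewrite -[vec3 _ _ _ 0 2]/(Pcoord _) vec3E.
  have -> : (fun X => f X 0 2) = (fun X => 2 / 3 * energy X * Pcoord X
        + Ucoord X ^+ 2 * (lambda - Pcoord X)).
    by apply/funext => X; have [_ _ <-] := vector_fieldE lambda X.
  apply: is_derive_eq.
  by rewrite /GRing.scale/= !vec3E energy_p; ring.
Qed.

(* Row vectors act on the left, so row i is the derivative in direction i. *)
Let jac (i j : nat) : R :=
  (nth [::] [:: [:: 4 * S0 * (S0 + r3 / 6); 0; 4 * S0 * P0];
                [:: 0; 1 - lambda / 2 * P0; 0];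
                [:: 2 * P0 * (S0 + r3 / 6); 0; 2 * P0 ^+ 2]] i)`_j.

Let jacobianE : 'J f p = \matrix_(i < 3, j < 3) jac i j.
Proof.
apply/matrixP => i j; rewrite mxE /lin1_mx mxE -deriveE; last first.
  exact: differentiable_vector_field.
have := is_derive_vector_field (delta_mx 0 i) => /= h; rewrite derive_val.
rewrite /Scoord /Ucoord /Pcoord !mxE /jac.
by case: i j {h} => [[|[|[|//]]] i3] [[|[|[|//]]] j3] /=; field.
Qed.

Let epsilons := [:: 0; 1 - lambda / 2 * P0; 2 / 3 * (2 + r3 * S0)].

(** The [U] direction decouples with eigenvalue [e2]. The [(S, P)] block has zero determinant, since
    the linearization there factors through the differential of the energy, so its eigenvalues are 0
    and its trace [a + d], which the ellipse equation turns into the third value. *)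
Lemma char_poly_jacobian :
  char_poly ('J f p) = \prod_(e <- epsilons) ('X - e%:P).
Proof.
rewrite jacobianE /char_poly.
have -> : char_poly_mx (\matrix_(i < 3, j < 3) jac i j) =
    \matrix_(i < 3, j < 3) ('X *+ (i == j :> nat) - (jac i j)%:P).
  by apply/matrixP => i j; rewrite !mxE.
rewrite (det_mx33 (fun i j => 'X *+ (i == j :> nat) - (jac i j)%:P)) /jac /=.
rewrite !big_cons big_nil.
set a := 4 * S0 * _; set b := 4 * S0 * P0; set c := 2 * P0 * _; set d := 2 * P0 ^+ 2.
set e2 := 1 - _.
have e3 : 2 / 3 * (2 + r3 * S0) = a + d.
  have -> : a + d = 4 / 3 * (3 * S0 ^+ 2 + 3 / 2 * P0 ^+ 2) + 2 / 3 * (r3 * S0).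
    by rewrite /a /d; field.
  by rewrite ellipse; field.
have abcd : a%:P * d%:P = b%:P * c%:P.
  by rewrite -!polyCM /a /b /c /d; congr (_%:P); ring.
rewrite e3 (polyCD a d) !polyC0; move: abcd.
move: a%:P b%:P c%:P d%:P e2%:P => A B C D E2 abcd.
transitivity (('X - E2) * ('X * 'X - (A + D) * 'X + (A * D - B * C))).
  by ring.
by rewrite abcd; ring.
Qed.

Lemma eigenvalue_jacobian (e : R) :
  eigenvalue ('J f p) e = (e \in epsilons).
Proof.
by rewrite eigenvalue_root_char char_poly_jacobian root_prod_XsubC.
Qed.

End Linearization.

Theorem mainTheorem8 (R : realType) (lambda : R) (lambda_ge0 : 0 <= lambda) :
  let f := vector_field lambda in
  (forall S0 P0 : R, Sigma (vec3 S0 0 P0) ->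
    let p := vec3 S0 0 P0 in
    let epsilons :=
      [:: 0; 1 - lambda / 2 * P0; 2 / 3 * (2 + Num.sqrt 3 * S0)] in
    [/\ f p = 0,
        char_poly ('J f p) = \prod_(e <- epsilons) ('X - e%:P) /\
        (forall e : R, eigenvalue ('J f p) e = (e \in epsilons)),
        2 < lambda * P0 -> ~ future_stable f p /\ ~ past_stable f p &
        lambda * P0 < 2 ->
          [/\ ~ future_stable f p,
              past_stable f p &
              \forall X \near p, past_converges f (@Sigma R) X]]) /\
  (lambda < Num.sqrt 6 ->
    exists N : set 'rV[R]_3,
      [/\ open N, @Sigma R `<=` N &
          forall X, N X -> past_converges f (@Sigma R) X]).
Proof.
move=> f; split=> [S0 P0 Sp p epsilons|lambda6].
  split.
  - exact: vector_field_Sigma.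
  - by split=> [|e]; [exact: char_poly_jacobian|exact: eigenvalue_jacobian].
  - by split; [exact: not_future_stable_Sigma|exact: not_past_stable_Sigma].
  - split; [exact: not_future_stable_Sigma|exact: past_stable_Sigma|].
    exact: past_converges_Sigma.
(* The convergence in (b) holds on a neighborhood of each point of [Sigma], so each lies in this
   interior. *)
exists (interior [set X | past_converges f (@Sigma R) X]); split.
- exact: open_interior.
- move=> X SX; have XE : X = vec3 (Scoord X) 0 (Pcoord X).
    apply/rowP => -[[|[|[|//]]] i3]; rewrite mxE /=.
    + by congr (X 0 _); exact/val_inj.
    + by case: SX => <- _; congr (X 0 _); exact/val_inj.
    + by congr (X 0 _); exact/val_inj.
  rewrite XE in SX *; apply: past_converges_Sigma => //.
  case: SX; rewrite !vec3E => _ ellipse.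
  move: (Scoord X) (Pcoord X) ellipse => S0 P0 ellipse.
  (* Hence [(lambda * P0)^2] is below [6 * (2 / 3) = 4], which is where the threshold [sqrt 6] comes
     from. *)
  have S2 := sqr_ge0 S0; have P2 : P0 ^+ 2 <= 2 / 3 by lra.
  have l2 : lambda ^+ 2 < 6.
    rewrite -[ltRHS](@sqr_sqrtr _ 6)//.
    by rewrite ltr_pXn2r ?nnegrE ?sqrtr_ge0.
  have : (lambda * P0) ^+ 2 < 2 ^+ 2.
    rewrite exprMn; have := sqr_ge0 P0; have := sqr_ge0 lambda; nra.
  by move=> lP; nra.
- by move=> X /interior_subset.
Qed.
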